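(* Let $(G,S)$ be a right-angled Artin group and let $w\in G$. Then the following assertions hold. (1) For all $a\in X_w$, $X_{w,a}$ is the convex closure of the union of its convex subsets $X_{p,a}$ for $p\in\mathrm{Prim}(w)$, and $X_{w,a}\cong\prod_{p\in\mathrm{Prim}(w)}X_{p,a}$ (isomorphism of median sets). (2) $X_w=\bigcap_{p\in\mathrm{Prim}(w)}X_p$. (3) The folding $\varphi_w$ is obtained by composing the pairwise commuting foldings $\varphi_p$ for $p\in\mathrm{Prim}(w)$. (4) For $u\in G$, one has $\varphi_u\le\varphi_w$, i.e. $X_u\subseteq X_w$, provided $\mathrm{Prim}(w)^{\sim}\subseteq\mathrm{Prim}(u)^{\sim}$.
   Context: $(G,S)$ is a right-angled Artin group: $S\subseteq G$ is a (possibly infinite) generating set of the group $G$ with $S\cap S^{-1}=\emptyset$, and $G$ has the presentation $\langle S\,;\,[s,t]=1$ for those $s\neq t$ in $S$ with $st=ts$ in $G\rangle$. Let $l$ be the word length on $G$ with respect to $S\cup S^{-1}$. Write $x\subset y$ iff $l(x)+l(x^{-1}y)=l(y)$; this is a partial order with least element $1$, in which any two elements have a greatest lower bound $x\cap y$. Elements $x,y$ are orthogonal, $x\perp y$, if $x\cap y=1$ and $x,y$ have a least upper bound for $\subset$ (equivalently, a common upper bound). Put $[x,y]=\{z\in G: x^{-1}z\subset x^{-1}y\}$ and $Y(x,y,z)=x(x^{-1}y\cap x^{-1}z)$, the unique element of $[x,y]\cap[y,z]\cap[z,x]$; the ternary operation $Y$ makes $G$ a median set. A subset $I$ is convex if $[x,y]\subseteq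 I$ for all $x,y\in I$; convex subsets are median sets with the restricted $Y$, and products carry the componentwise operation. The convex closure of a set is the smallest convex set containing it. A folding of $G$ is a map $\varphi:G\to G$ with $\varphi(Y(x,y,z))=Y(\varphi(x),y,\varphi(z))$ for all $x,y,z$; foldings are ordered by $\varphi\le\psi\iff\varphi(G)\subseteq\psi(G)$. An element $w$ is cyclically reduced if $w\cap w^{-1}=1$. For $w\in G$ put $\varphi_w(x)=Y(wx,x,w^{-1}x)$, which is a folding of $G$, and $X_w=\varphi_w(G)=\{x\in G: x^{-1}wx \text{ is cyclically reduced}\}$. For $a\in X_w$ let $X_{w,a}$ be the convex closure of $\{w^na:n\in\mathbb Z\}$. For a cyclically reduced $v$ put $H_v=Z_G(v)\cap X_{v,1}$. An element $w\neq1$ is primitive if for some (equivalently, for all) $a\in X_w$ the group $H_{a^{-1}wa}$ is cyclic, generated by $a^{-1}wa$. Every $w\in G$ can be written, uniquely up to order of the factors, as $w=\prod_{i=1}^n p_i^{m_i}$ with $p_i$ primitive, $m_i\ge1$, and $a^{-1}p_ia\perp a^{-1}p_ja$ for all $i\neq j$ and all $a\in X_w$; $\mathrm{Prim}(w)=\{p_1,\dots,p_n\}$ (so $\mathrm{Prim}(1)=\emptyset$), and $\mathrm{Prim}(w)^{\sim}=\mathrm{Prim}(w)\cup\mathrm{Prim}(w^{-1})=\mathrm{Prim}(w)\cup\mathrm{Prim}(w)^{-1}$. Conventions for $w=1$: the empty intersection of subsets of $G$ is $G$, the empty composition is the identity, the empty product is a point, and the empty union in (1) is read as $\{a\}$.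 *)

(* Defs.v *)
From HB Require Import structures.
From mathcomp Require Import all_boot.
From mathcomp Require Import mathcomp_extra boolp classical_sets functions.
From mathcomp Require Import cardinality.

Set Implicit Arguments.
Unset Strict Implicit.
Unset Printing Implicit Defensive.

Local Open Scope classical_set_scope.
Local Open Scope group_scope.

(** * Group presentations *)

(* A letter (s, true) stands for s, a letter (s, false) for its formal inverse;
   a word is read from left to right. *)
Definition letter_val (G : groupType) (x : G * bool) : G :=
  if x.2 then x.1 else x.1^-1.

Definition word_val (G : groupType) (u : seq (G * bool)) : G :=
  \prod_(x <- u) letter_val x.

Definition words (G : groupType) (S : set G) : set (seq (G * bool)) :=
  [set u | forall x, x \in u -> S x.1].

(* Equality of words over S in the group <S ; R>. *)
Inductive pres_eq (G : groupType) (S : set G) (R : set (seq (G * bool))) :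
    seq (G * bool) -> seq (G * bool) -> Prop :=
| pres_refl u : pres_eq S R u u
| pres_sym u v : pres_eq S R u v -> pres_eq S R v u
| pres_trans u v t : pres_eq S R u v -> pres_eq S R v t -> pres_eq S R u t
| pres_cancel u v s e : S s ->
    pres_eq S R (u ++ [:: (s, e); (s, ~~ e)] ++ v) (u ++ v)
| pres_relator u v r : R r -> pres_eq S R (u ++ r ++ v) (u ++ v).

(* S generates G, and the kernel of F(S) -> G is the normal closure of R. *)
Definition presented_by (G : groupType) (S : set G)
    (R : set (seq (G * bool))) : Prop :=
  (forall x : G, exists2 u, words S u & word_val u = x) /\
  (forall u, words S u -> (word_val u = 1 <-> pres_eq S R u [::])).

Definition commutation_relators (G : groupType) (S : set G) :
    set (seq (G * bool)) :=
  [set r | exists s t : G, [/\ S s, S t, s <> t, s * t = t * s &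
     r = [:: (s, true); (t, true); (s, false); (t, false)]]].

Definition raag (G : groupType) (S : set G) : Prop :=
  (forall s, S s -> ~ S s^-1) /\ presented_by S (commutation_relators S).

(** * Length, order, median *)

(* Well defined as soon as S generates G; the default value 0 is then never
   used. *)
Definition len (G : groupType) (S : set G) (x : G) : nat :=
  let sizes := [set size u | u in [set u | words S u /\ word_val u = x]] in
  xget 0%N [set n | sizes n /\ forall m, sizes m -> (n <= m)%N].

Definition prec (G : groupType) (S : set G) (x y : G) : Prop :=
  (len S x + len S (x^-1 * y)%g)%N = len S y.

Definition is_glb (G : groupType) (S : set G) (x y z : G) : Prop :=
  [/\ prec S z x, prec S z y &
      forall t, prec S t x -> prec S t y -> prec S t z].

Definition is_lub (G : groupType) (S : set G) (x y z : G) : Prop :=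
  [/\ prec S x z, prec S y z &
      forall t, prec S x t -> prec S y t -> prec S z t].

(* In a right-angled Artin group the greatest lower bound exists and is unique,
   so that the default value 1 is not used. *)
Definition meet (G : groupType) (S : set G) (x y : G) : G :=
  xget 1 (is_glb S x y).

Definition orthogonal (G : groupType) (S : set G) (x y : G) : Prop :=
  meet S x y = 1 /\ exists z, is_lub S x y z.

Definition interval (G : groupType) (S : set G) (x y : G) : set G :=
  [set z | prec S (x^-1 * z) (x^-1 * y)].

Definition Y (G : groupType) (S : set G) (x y z : G) : G :=
  x * meet S (x^-1 * y) (x^-1 * z).

Definition convex (G : groupType) (S : set G) (I : set G) : Prop :=
  forall x y, I x -> I y -> interval S x y `<=` I.

Definition convex_closure (G : groupType) (S : set G) (A : set G) : set G :=
  smallest (convex S) A.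

(** * Products and isomorphisms of median sets *)

Definition componentwise (I T : Type) (m : T -> T -> T -> T)
    (f g h : I -> T) : I -> T :=
  fun i => m (f i) (g i) (h i).

Definition prod_set (I T : Type) (F : I -> set T) : set (I -> T) :=
  [set f | forall i, F i (f i)].

(* A and B, with the operations restricted from mT and mU, are isomorphic. *)
Definition median_iso (T U : Type) (mT : T -> T -> T -> T)
    (mU : U -> U -> U -> U) (A : set T) (B : set U) : Prop :=
  exists2 f : T -> U, set_bij A B f &
    forall x y z, A x -> A y -> A z -> f (mT x y z) = mU (f x) (f y) (f z).

(** * Foldings *)

Definition folding (G : groupType) (S : set G) (phi : G -> G) : Prop :=
  forall x y z, phi (Y S x y z) = Y S (phi x) y (phi z).

Definition folding_le (G : groupType) (phi psi : G -> G) : Prop :=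
  range phi `<=` range psi.

Definition phi (G : groupType) (S : set G) (w : G) : G -> G :=
  fun x => Y S (w * x) x (w^-1 * x).

Definition X (G : groupType) (S : set G) (w : G) : set G := range (phi S w).

(** * Primitive elements *)

Definition zpowers (G : groupType) (w : G) : set G :=
  [set x | exists n : nat, x = w ^+ n \/ x = w ^- n].

Definition Xa (G : groupType) (S : set G) (w a : G) : set G :=
  convex_closure S [set z * a | z in zpowers w].

Definition centralizer (G : groupType) (v : G) : set G :=
  [set z | z * v = v * z].

Definition H (G : groupType) (S : set G) (v : G) : set G :=
  centralizer v `&` Xa S v 1.

(* Here w ^ a is the conjugate of w by a, namely a^-1 * (w * a). *)
Definition primitive (G : groupType) (S : set G) (w : G) : Prop :=
  w <> 1 /\ exists2 a, X S w a & H S (w ^ a) = zpowers (w ^ a).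

Definition primitive_decomposition (G : groupType) (S : set G) (w : G)
    (n : nat) (p : 'I_n -> G) (m : 'I_n -> nat) : Prop :=
  [/\ w = \prod_(i < n) p i ^+ m i,
      forall i, primitive S (p i),
      forall i, (1 <= m i)%N &
      forall i j, i <> j -> forall a, X S w a ->
        orthogonal S (p i ^ a) (p j ^ a)].

(* The decomposition of w exists and is unique up to the order of the factors,
   so this is the set of factors of any of its decompositions. *)
Definition Prim (G : groupType) (S : set G) (w : G) : set G :=
  [set q | exists n (p : 'I_n -> G) (m : 'I_n -> nat),
     primitive_decomposition S w p m /\ exists i, q = p i].

Definition Prim_sym (G : groupType) (S : set G) (w : G) : set G :=
  Prim S w `|` Prim S w^-1.

(* The union of a family of subsets containing a, read as {a} for the empty
   family. *)
Definition pointed_bigcup (T U : Type) (a : T) (P : set U) (F : U -> set T) :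
    set T :=
  if P == set0 then [set a] else \bigcup_(p in P) F p.

(* Main.v *)
(* Call wall the class of the edges of the Cayley graph labelled by s and based
   in a fixed left coset of the group generated by the link of s.  The signed
   count of the crossings of a wall by a word is invariant under the relators,
   and a geodesic crosses no wall twice; hence x is determined by the set N(x) of
   the walls separating 1 from x, x precedes y iff N(x) is contained in N(y), and
   medians are computed by a majority vote wall by wall.  Two walls with four
   inhabited quadrants have distinct commuting types, so that a wall and its
   translate by w are nested.  Either w or its inverse maps a side H of the wall
   into itself, and then phi_w preserves H, or the translates of some side H by
   the powers of w are disjoint from H, and then X_w avoids H.  Thus X_w is cut
   out by the walls of the second kind, and X_{w,a} consists of the points
   separated from a by axial walls only, those of the first kind which are not
   fixed by w.
   If w is a product of factors with commuting disjoint supports, an axial wall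
   of w is an axial wall of exactly one factor, and every other factor fixes it;
   all four assertions follow by looking at each wall.  Counting the axial walls
   of each type with the direction in which v moves them embeds H_v into an
   abelian group; this yields the existence and the uniqueness of the primitive
   decomposition. *)
Require Import Defs.
From HB Require Import structures.
From mathcomp Require Import all_boot all_order ssralg ssrnum ssrint zify.
From mathcomp Require Import mathcomp_extra boolp classical_sets functions.
From mathcomp Require Import cardinality.

Set Implicit Arguments.
Unset Strict Implicit.
Unset Printing Implicit Defensive.

Import GRing.Theory.

Local Open Scope classical_set_scope.
Local Open Scope group_scope.

(** The relations of G are used in one place, the independence of [wsum] from the word, and there
    for an arbitrary integer weight on walls. This generality pays twice: a Dirac weight detects the
    walls crossed by an element, and a weight invariant under the centralizer of v turns the cocycle
    into homomorphisms to the integers, so that [H S v] is understood without any normal form for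
    centralizers. The obstacle is the passage from w to its powers. A power might stabilise a wall
    that w moves, for instance if w exchanged the two sides; a wall of the second kind for w could
    then be of the first kind for a power, and an orbit of walls could be finite. This cannot
    happen: stabilisers of walls are conjugates of link subgroups, membership in these is a
    condition on supports, and an element has the same support as its positive powers. Convex
    closures are handled by one device, a nearest point y of a convex set to x: no wall between x
    and y cuts the set. *)

Section Words.
Variables (G : groupType) (S : set G).
Implicit Types (x y z g h s t : G) (u v : seq (G * bool)) (b : bool).

(** * Words and their values *)

Definition adj s t : Prop := [/\ S s, S t, s <> t & s * t = t * s].

Lemma adj_sym s t : adj s t -> adj t s.
Proof. by case=> Ss St st c; split=> // ts; apply: st. Qed.

Lemma word_val_cat u v : word_val (u ++ v) = word_val u * word_val v.
Proof. by rewrite /word_val big_cat. Qed.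

Lemma word_val_cons a u : word_val (a :: u) = letter_val a * word_val u.
Proof. by rewrite /word_val big_cons. Qed.

Lemma word_val_nil : word_val [::] = 1 :> G.
Proof. by rewrite /word_val big_nil. Qed.

Lemma words_cat u v : words S (u ++ v) <-> words S u /\ words S v.
Proof.
split=> [h|[hu hv] x]; last by rewrite mem_cat => /orP[/hu|/hv].
by split=> x xu; apply: h; rewrite mem_cat xu ?orbT.
Qed.

Lemma words_cons a u : words S (a :: u) <-> S a.1 /\ words S u.
Proof.
split=> [h|[ha hu] x]; last by rewrite inE => /orP[/eqP->|/hu].
by split=> [|x xu]; apply: h; rewrite inE ?eqxx ?xu ?orbT.
Qed.

Definition winv u : seq (G * bool) := rev [seq (a.1, ~~ a.2) | a <- u].

Lemma letter_valN s b : letter_val (s, ~~ b) = (letter_val (s, b))^-1.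
Proof. by case: b => //=; rewrite /letter_val /= invgK. Qed.

Lemma word_val_winv u : word_val (winv u) = (word_val u)^-1.
Proof.
elim: u => [|[s b] u IH]; first by rewrite /winv /= word_val_nil invg1.
rewrite /winv /= rev_cons -cats1 word_val_cat IH !word_val_cons.
by rewrite word_val_nil mulg1 letter_valN invgM.
Qed.

Lemma words_winv u : words S u -> words S (winv u).
Proof. by move=> h x; rewrite mem_rev => /mapP[y /h ? ->]. Qed.

(** * Walls *)

(* A wall is a hyperplane of the cube complex of G: the class of the edges
   (h, h s) with h in a fixed left coset of the subgroup generated by the
   link of s, encoded as the pair of s and the coset. *)
Definition wall : Type := (G * set G)%type.

Definition act g (W : wall) : wall := (W.1, [set x | W.2 (g^-1 * x)]).

Definition Lk s : set G :=
  [set h | exists2 u, (forall a, a \in u -> adj s a.1) & word_val u = h].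

(** The wall crossed by the path from 1 to [letter_val a]; for an inverse letter the positively
    oriented edge starts at s^-1, whence the translate. *)
Definition edge (a : G * bool) : wall :=
  if a.2 then (a.1, Lk a.1) else act a.1^-1 (a.1, Lk a.1).

Lemma edge1 a : (edge a).1 = a.1.
Proof. by rewrite /edge; case: a.2. Qed.

Lemma act1 W : act 1 W = W.
Proof.
case: W => s A; congr pair; apply/funext => x /=.
by rewrite /mkset invg1 mul1g.
Qed.

Lemma actM g h W : act (g * h) W = act g (act h W).
Proof.
by congr pair; apply/funext => x /=; rewrite /mkset invgM mulgA.
Qed.

Lemma actK g : cancel (act g) (act g^-1).
Proof. by move=> W; rewrite -actM mulVg act1. Qed.

Lemma actVK g : cancel (act g^-1) (act g).
Proof. by move=> W; rewrite -actM mulgV act1. Qed.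

Lemma act_inj g : injective (act g).
Proof. exact: can_inj (actK g). Qed.

Lemma Lk1 s : Lk s 1.
Proof. by exists [::] => //; rewrite word_val_nil. Qed.

Lemma LkM s g h : Lk s g -> Lk s h -> Lk s (g * h).
Proof.
move=> [u hu <-] [v hv <-]; exists (u ++ v); last by rewrite word_val_cat.
by move=> a; rewrite mem_cat => /orP[/hu|/hv].
Qed.

Lemma LkV s g : Lk s g -> Lk s g^-1.
Proof.
move=> [u hu <-]; exists (winv u); last by rewrite word_val_winv.
by move=> a; rewrite mem_rev => /mapP[b /hu ? ->].
Qed.

Lemma Lk_adj s t b : adj s t -> Lk s (letter_val (t, b)).
Proof.
move=> st; exists [:: (t, b)]; last by rewrite word_val_cons word_val_nil mulg1.
by move=> a; rewrite inE => /eqP->.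
Qed.

Lemma Lk_comm s g : Lk s g -> commute s g.
Proof.
move=> [u + <-] {g}; elim: u => [|[t b] u IH] h; first by rewrite word_val_nil;
  apply: commute1.
rewrite word_val_cons; apply: commuteM; last by apply: IH => a au; apply: h;
  rewrite inE au orbT.
have [_ _ _ /= c] := h (t, b) (mem_head _ _).
by rewrite /letter_val /=; case: (b); [|apply: commuteV].
Qed.

Lemma act_Lk s g : act g (s, Lk s) = (s, Lk s) <-> Lk s g.
Proof.
split=> [/(congr1 snd) /= e|h].
  have h := Lk1 s; rewrite -e /mkset mulg1 in h.
  by rewrite -(invgK g); apply: LkV.
congr pair; apply/seteqP; split=> x /= hx; last by apply: LkM => //; apply: LkV.
by rewrite -(mulVKg g x); apply: LkM.
Qed.

(** For an inverse letter the stabiliser is a conjugate of the link subgroup by s, hence that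
    subgroup itself, as s commutes with its link. *)
Lemma act_edge a g : act g (edge a) = edge a <-> Lk a.1 g.
Proof.
rewrite /edge; case: a.2; first exact: act_Lk.
set s := a.1; set E := (s, _).
have -> : (act g (act s^-1 E) = act s^-1 E) <-> (act (s * g / s) E = E).
  rewrite !actM; split=> [->|e]; first by rewrite actVK.
  by apply: (@act_inj s); rewrite actVK.
rewrite act_Lk; split=> h; last by rewrite (Lk_comm h) mulgK.
suff -> : g = s * g / s by [].
by have c := Lk_comm h; rewrite -[RHS](mulKg s) c mulgVK mulKg.
Qed.

(* The wall of a letter and that of its inverse bound the same edge. *)
Lemma edgeN s b : edge (s, ~~ b) = act (letter_val (s, b))^-1 (edge (s, b)).
Proof. by case: b; rewrite /edge /letter_val //= invgK actVK. Qed.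

(** * Cocycles *)

Fixpoint wpath u : seq (wall * bool) :=
  if u is a :: u' then
    (edge a, a.2) :: [seq (act (letter_val a) p.1, p.2) | p <- wpath u']
  else [::].

Definition sgn b : int := if b then 1%R else (-1)%R.

Definition wsum (w : wall -> int) u : int :=
  (\sum_(p <- wpath u) sgn p.2 * w p.1)%R.

Lemma wsum_nil w : wsum w [::] = 0%R.
Proof. by rewrite /wsum big_nil. Qed.

Lemma wsum_cons w a u :
  wsum w (a :: u) =
    (sgn a.2 * w (edge a) + wsum (w \o act (letter_val a)) u)%R.
Proof. by rewrite /wsum /= big_cons big_map. Qed.

Lemma wsum_cat w u v :
  wsum w (u ++ v) = (wsum w u + wsum (w \o act (word_val u)) v)%R.
Proof.
elim: u w => [|a u IH] w.
  rewrite wsum_nil add0r word_val_nil; congr wsum.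
  by apply/funext => W /=; rewrite act1.
rewrite cat_cons !wsum_cons IH addrA; congr (_ + wsum _ _)%R.
by apply/funext => W /=; rewrite word_val_cons actM.
Qed.

(** Opposite edges of the square of a commutation relator lie on one wall, because s and t fix each
    other's walls, and they are traversed in opposite directions. A relator has value 1, so the
    suffix after it sees the same weight. *)
Lemma pres_eq_invariant u v : pres_eq S (commutation_relators S) u v ->
  word_val u = word_val v /\ forall w, wsum w u = wsum w v.
Proof.
elim=> {u v} [u|u v _ [e1 e2]|u v t _ [e1 e2] _ [e3 e4]|u v s b Ss|u v r].
- by [].
- by split=> // w; rewrite e2.
- by split=> [|w]; [rewrite e1|rewrite e2].
- have e : word_val [:: (s, b); (s, ~~ b)] = 1.
    by rewrite !word_val_cons word_val_nil mulg1 letter_valN mulgV.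
  split=> [|w]; first by rewrite !word_val_cat e mul1g.
  rewrite !wsum_cat e; congr (_ + _)%R.
  rewrite !wsum_cons wsum_nil /= addr0 edgeN actVK.
  have -> : (sgn (~~ b) = - sgn b)%R by case: b {e}; rewrite ?opprK.
  rewrite mulNr subrr add0r; congr wsum.
  by apply/funext => W /=; rewrite act1.
- case=> s [t [Ss St nst c ->]].
  have e : word_val [:: (s, true); (t, true); (s, false); (t, false)] = 1.
    rewrite !word_val_cons word_val_nil mulg1 /letter_val /= mulgA c.
    by rewrite -mulgA mulVKg mulgV.
  split=> [|w]; first by rewrite !word_val_cat e mul1g.
  rewrite !wsum_cat e; congr (_ + _)%R.
  have st : adj s t by [].
  have h1 : act s (edge (t, true)) = edge (t, true).
    by apply/act_edge; apply: (Lk_adj true (adj_sym st)).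
  have h2 : act t (edge (s, true)) = edge (s, true).
    by apply/act_edge; apply: (Lk_adj true st).
  rewrite !wsum_cons wsum_nil /= addr0.
  have -> : act (letter_val (s, true)) (edge (t, true)) = edge (t, true) by [].
  rewrite (edgeN s true) (edgeN t true).
  have -> : act (letter_val (s, true)) (act (letter_val (t, true))
      (act (letter_val (s, true))^-1 (edge (s, true)))) = edge (s, true).
    by rewrite -actM /letter_val /= c actM actVK.
  have -> : act (letter_val (s, true)) (act (letter_val (t, true))
     (act (letter_val (s, false)) (act (letter_val (t, true))^-1 (edge (t, true))))) =
     edge (t, true).
    by rewrite -!actM /letter_val /= c mulgK mulgV act1.
  rewrite (_ : (_ + (_ + (_ + _)) = 0)%R); last by rewrite /sgn; lia.
  rewrite add0r; congr wsum.
  by apply/funext => W /=; rewrite act1.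
Qed.

End Words.

(** * Geodesics and crossing numbers *)

Section Raag.
Variables (G : groupType) (S : set G).
Implicit Types (x y z g h s t : G) (u v : seq (G * bool)).
Implicit Types (W V : wall G).

Definition geodesic u x : Prop :=
  [/\ words S u, word_val u = x &
      forall v, words S v -> word_val v = x -> (size u <= size v)%N].

Definition gd x : seq (G * bool) := xget [::] [set u | geodesic u x].

Definition walls u : seq (wall G) := unzip1 (wpath S u).

(** Any word over S with value x gives the same sum, which makes this a cocycle for the action of G
    on weights. *)
Definition coc (w : wall G -> int) x : int := wsum S w (gd x).

Definition dirac W W' : int := (W' == W)%:R%R.

(* The signed number of crossings of W by a path from 1 to x. *)
Definition crs W x : int := coc (dirac W) x.

Lemma walls_cons a u :
  walls (a :: u) = edge S a :: map (act (letter_val a)) (walls u).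
Proof. by rewrite /walls /unzip1 /= -!map_comp. Qed.

Lemma walls_cat u v :
  walls (u ++ v) = walls u ++ map (act (word_val u)) (walls v).
Proof.
elim: u => [|a u IH]; last first.
  rewrite cat_cons !walls_cons IH map_cat -map_comp cat_cons; congr (_ :: _ ++ _).
  by apply: eq_map => W /=; rewrite word_val_cons actM.
by rewrite word_val_nil /=; symmetry; apply: map_id_in => W _; apply: act1.
Qed.

Lemma size_walls u : size (walls u) = size u.
Proof. by elim: u => // a u IH; rewrite walls_cons /= size_map IH. Qed.

Lemma mem_walls u W : W \in walls u ->
  exists u1 b u2, u = u1 ++ b :: u2 /\ W = act (word_val u1) (edge S b).
Proof.
elim: u W => [|a u IH] W //; rewrite walls_cons inE => /orP[/eqP->|].
  by exists [::], a, u; rewrite word_val_nil act1.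
case/mapP => V /IH[u1 [b [u2 [-> ->]]]] ->.
by exists (a :: u1), b, u2; rewrite word_val_cons actM.
Qed.

Lemma mem_walls_type u a : a \in u -> exists2 W, W \in walls u & W.1 = a.1.
Proof.
case/splitPr => u1 u2; exists (act (word_val u1) (edge S a)).
  by rewrite walls_cat mem_cat walls_cons map_f ?orbT // inE eqxx.
by rewrite /= edge1.
Qed.

Lemma walls_type u W : W \in walls u -> exists2 a, a \in u & W.1 = a.1.
Proof.
case/mem_walls=> u1 [b [u2 [-> ->]]]; exists b; last by rewrite /= edge1.
by rewrite mem_cat inE eqxx orbT.
Qed.

Lemma wsum0 w u : (forall W, W \in walls u -> w W = 0%R) -> wsum S w u = 0%R.
Proof.
move=> h; rewrite /wsum big_seq big1 // => p pu.
by rewrite h ?mulr0 // /walls map_f.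
Qed.

Lemma dirac_act W g : dirac W \o act g = dirac (act g^-1 W).
Proof.
apply/funext => V /=; rewrite /dirac; congr (nat_of_bool _)%:R%R.
by apply/eqP/eqP => [<-|->]; rewrite ?actK ?actVK.
Qed.

Hypothesis hGS : raag S.

Lemma gdP x : geodesic (gd x) x.
Proof.
have [_ [gen _]] := hGS; have [u0 Su0 u0x] := gen x.
have ex : exists n, `[< exists2 u, words S u /\ word_val u = x & size u = n >].
  by exists (size u0); apply/asboolP; exists u0.
case: (ex_minnP ex) => n /asboolP[u [Su ux] nu] nmin.
suff : [set u | geodesic u x] (gd x) by [].
apply: xgetPex; exists u; split=> // v Sv vx.
by rewrite nu; apply: nmin; apply/asboolP; exists v.
Qed.

Lemma gd_words x : words S (gd x). Proof. by case: (gdP x). Qed.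
Lemma gd_val x : word_val (gd x) = x. Proof. by case: (gdP x). Qed.
Lemma gd_min x u : words S u -> word_val u = x -> (size (gd x) <= size u)%N.
Proof. by case: (gdP x) => _ _; apply. Qed.

Lemma lenE x : len S x = size (gd x).
Proof.
rewrite /len; set A := [set n | _].
have : A (size (gd x)).
  split; first by exists (gd x) => //; split; [apply: gd_words|apply: gd_val].
  by move=> _ [u [Su ux] <-]; apply: gd_min.
move=> h; have [h1 h2] : A (xget 0%N A) by apply: xgetPex; exists (size (gd x)).
case: h => h3 h4; apply/eqP; rewrite eqn_leq; apply/andP; split.
  exact: h2.
exact: h4.
Qed.

(** The presentation speaks of words of value 1 only, so both words are closed up by the same
    inverse of [v]. *)
Lemma wsum_eq w u v : words S u -> words S v -> word_val u = word_val v ->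
  wsum S w u = wsum S w v.
Proof.
move=> Su Sv e; have [_ [_ pres]] := hGS.
have key (t : seq (G * bool)) : words S t -> word_val t = word_val v ->
    (wsum S w t + wsum S (w \o act (word_val v)) (winv v) = 0)%R.
  move=> St et; have : word_val (t ++ winv v) = 1.
    by rewrite word_val_cat word_val_winv et mulgV.
  have St' : words S (t ++ winv v) by apply/words_cat; split=> //; apply: words_winv.
  by move=> /(pres _ St') /pres_eq_invariant[_ /(_ w)]; rewrite wsum_cat wsum_nil et.
by have := key u Su e; have := key v Sv erefl; lia.
Qed.

Lemma wsum_coc w u : words S u -> wsum S w u = coc w (word_val u).
Proof. by move=> Su; apply: wsum_eq => //; rewrite ?gd_val //; apply: gd_words. Qed.

Lemma cocM w x y : coc w (x * y) = (coc w x + coc (w \o act x) y)%R.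
Proof.
rewrite -{1}(gd_val x) -{1}(gd_val y) -word_val_cat -wsum_coc.
  by rewrite wsum_cat gd_val.
by apply/words_cat; split; apply: gd_words.
Qed.

Lemma coc1 w : coc w 1 = 0%R.
Proof. by rewrite -(word_val_nil G) -wsum_coc ?wsum_nil. Qed.

Lemma crsM W x y : crs W (x * y) = (crs W x + crs (act x^-1 W) y)%R.
Proof. by rewrite /crs cocM dirac_act. Qed.

Lemma coc_Lk s w k : Lk S s k ->
  (forall W, W.1 <> s -> w W = 0%R) -> coc w k = 0%R.
Proof.
move=> [u hu <-] w0; rewrite -wsum_coc; last by move=> a /hu [].
apply: wsum0 => W /walls_type[a /hu[_ _ sa _] Wa]; apply: w0.
by rewrite Wa => /esym.
Qed.

(* Between two consecutive crossings of a wall, a word evaluates in the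
   stabiliser of the wall, so both crossings can be deleted. *)
Lemma deletion u : words S u -> ~~ uniq (walls u) ->
  exists v, [/\ words S v, word_val v = word_val u & (size v < size u)%N].
Proof.
elim: u => [|a u IH] // /words_cons[Sa Su].
rewrite walls_cons /= negb_and negbK map_inj_uniq; last exact: act_inj.
case: (boolP (uniq (walls u))) => [uu|nu] /=; last first.
  move=> _; have [v [Sv vu sv]] := IH Su nu.
  exists (a :: v); split=> //; first by apply/words_cons.
  by rewrite !word_val_cons vu.
rewrite orbF => /mapP[W Wu Wa].
have [u1 [b [u2 [eu eW]]]] := mem_walls Wu; subst u.
have /words_cat[Su1 /words_cons[Sb Su2]] := Su.
have Wu1 : W \notin walls u1.
  move: uu; rewrite walls_cat cat_uniq => /and3P[_ /hasPn h _].
  apply: h; rewrite walls_cons map_cons inE -eW eqxx //.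
have ab : a.1 = b.1 by rewrite -(edge1 S a) Wa eW /= edge1.
have eab : edge S a = act (letter_val a * word_val u1) (edge S b).
  by rewrite actM -eW.
(* Two consecutive crossings in the same direction are impossible: [a :: u1] would have its value in
   the link subgroup, where walls of type [a.1] have count 0, yet it crosses [edge S a] exactly
   once. *)
case: (boolP (b.2 == a.2)) => [/eqP e2|/eqP ne2].
  have {ab e2} e : b = a by rewrite (surjective_pairing a) (surjective_pairing b) ab
    e2.
  rewrite {}e in eab.
  have : Lk S a.1 (word_val (a :: u1)) by rewrite word_val_cons; apply/act_edge.
  move=> /(@coc_Lk _ (dirac (edge S a))).
  rewrite -wsum_coc; last by apply/words_cons.
  have -> : wsum S (dirac (edge S a)) (a :: u1) = sgn a.2.
    rewrite wsum_cons wsum0 ?addr0 => [|V Vu] /=; last first.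
      rewrite /dirac; case: eqP => // /esym e; case/negP: Wu1.
      by have := e; rewrite {1}Wa => /act_inj ->.
    by rewrite /dirac eqxx mulr1.
  move=> e; have /e : forall V : wall G, V.1 <> a.1 -> dirac (edge S a) V = 0%R.
    by move=> V; rewrite /dirac; case: eqP => // ->; rewrite edge1.
  by case: (a.2).
have eb : b = (a.1, ~~ a.2).
  by rewrite (surjective_pairing b) ab; congr pair; case: (a.2) (b.2) ne2 => -[].
move: eab; rewrite eb edgeN -surjective_pairing -actM => /esym/act_edge hk.
(* The letter commutes with its conjugate of [word_val u1], hence with [word_val u1], and so it
   cancels against [b]. *)
have c : commute (letter_val a) (letter_val a * word_val u1 / letter_val a).
  have := Lk_comm hk; rewrite /letter_val; case: (a.2) => // h.
  by apply: commute_sym; apply: commuteV; apply: commute_sym.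
exists (u1 ++ u2); split; [by apply/words_cat| |]; last first.
  by rewrite !size_cat /=; lia.
rewrite word_val_cons !word_val_cat word_val_cons letter_valN -surjective_pairing.
rewrite !mulgA; congr (_ * _).
by rewrite -[RHS](mulKg (letter_val a)) c mulgVK mulKg.
Qed.

Lemma uniq_gd x : uniq (walls (gd x)).
Proof.
case: (boolP (uniq _)) => // /(deletion (@gd_words x))[v [Sv vx]].
by rewrite ltnNge gd_min // vx gd_val.
Qed.

Lemma wsum_dirac u W : uniq (walls u) ->
  wsum S (dirac W) u = if W \in walls u then sgn (nth false (unzip2 (wpath S u))
    (index W (walls u))) else 0%R.
Proof.
rewrite /wsum /walls; elim: (wpath S u) => [|[V e] p IH] /=; first by rewrite big_nil.
case/andP=> Vp up; rewrite big_cons IH //= inE /dirac eq_sym.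
case: (eqVneq V W) => [<-|] /=; last first.
  by rewrite mulr0 add0r.
by rewrite (negbTE Vp) addr0 mulr1.
Qed.

Lemma crs_mem u W : words S u -> uniq (walls u) ->
  (W \in walls u) = (crs W (word_val u) != 0%R).
Proof.
move=> Su uu; rewrite /crs -wsum_coc // wsum_dirac //.
by case: ifP => //; case: (nth _ _ _).
Qed.

Definition Nw x := walls (gd x).

Lemma mem_Nw x W : (W \in Nw x) = (crs W x != 0%R).
Proof. by rewrite crs_mem ?gd_val //; [apply: gd_words|apply: uniq_gd]. Qed.

Lemma uniq_Nw x : uniq (Nw x). Proof. exact: uniq_gd. Qed.

Lemma size_Nw x : size (Nw x) = len S x.
Proof. by rewrite lenE size_walls. Qed.

Lemma Nw_word u : words S u -> uniq (walls u) -> Nw (word_val u) =i walls u.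
Proof. by move=> Su uu W; rewrite mem_Nw crs_mem. Qed.

(** A word that meets no wall twice is geodesic: its walls are those with nonzero crossing number,
    and a geodesic meets exactly the same ones. *)
Lemma len_word u : words S u -> uniq (walls u) -> len S (word_val u) = size u.
Proof.
move=> Su uu; rewrite -size_Nw -size_walls; apply/perm_size/uniq_perm => //.
  exact: uniq_Nw.
exact: Nw_word.
Qed.

Lemma crs_bound x W : (-1 <= crs W x <= 1)%R.
Proof.
rewrite /crs /coc wsum_dirac ?uniq_gd //.
by case: ifP => //; case: (nth _ _ _).
Qed.

Lemma coc_Nw w x : coc w x = (\sum_(W <- Nw x) crs W x * w W)%R.
Proof.
have h (p : wall G * bool) : p \in wpath S (gd x) -> crs p.1 x = sgn p.2.
  rewrite /crs /coc wsum_dirac ?uniq_gd // => pu.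
  rewrite /walls map_f // (_ : nth _ _ _ = p.2) //.
  have := uniq_gd x; rewrite /walls.
  elim: (wpath S (gd x)) pu => //= q l IH; rewrite inE => /orP[/eqP<-|pl].
    by rewrite eqxx.
  case/andP=> ql ul; case: eqP => [e|_]; last exact: IH.
  by case/negP: ql; rewrite e map_f.
rewrite /coc /wsum /Nw /walls /unzip1 big_map big_seq [RHS]big_seq.
by apply: eq_bigr => p /h ->.
Qed.

(** * Sides of walls and intervals *)

(** Depending on the side of 1, the crossing number takes the values 0 and 1 or the values -1 and 0.
    Asking for the larger value removes the base point, so that sides are equivariant; a pair that
    is not a wall gets the constant [false]. *)
Definition pos W x : bool := `[< exists y, (crs W y < crs W x)%R >].

Lemma crs_diff W x y : (-1 <= crs W y - crs W x <= 1)%R.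
Proof.
have := crsM W x (x^-1 * y); rewrite mulVKg => ->.
by have := crs_bound (x^-1 * y) (act x^-1 W); lia.
Qed.

Lemma posM g W x : pos (act g W) (g * x) = pos W x.
Proof.
have e y : crs (act g W) (g * y) = (crs (act g W) g + crs W y)%R by rewrite crsM actK.
apply/asboolP/asboolP => -[y h].
  by have := e (g^-1 * y); rewrite mulVKg => ey; exists (g^-1 * y); move: h;
    rewrite e; lia.
by exists (g * y); rewrite !e; lia.
Qed.

Lemma posV g W x : pos (act g^-1 W) x = pos W (g * x).
Proof. by rewrite -(posM g) actVK. Qed.

Lemma pos_act g W x : pos (act g W) x = pos W (g^-1 * x).
Proof. by rewrite -{1}(mulVKg g x) posM. Qed.

Lemma pos_crs W x y : (crs W x < crs W y)%R -> pos W y /\ ~~ pos W x.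
Proof.
move=> h; split; first by apply/asboolP; exists x.
by apply/asboolP => -[z]; have := crs_diff W z y; lia.
Qed.

Lemma pos_sep W x y : (pos W x != pos W y) = (crs W x != crs W y).
Proof.
case: (Order.TotalTheory.ltgtP (crs W x) (crs W y)) =>
  [/pos_crs[-> /negbTE->]|/pos_crs[-> /negbTE->]|] //.
by move=> e; rewrite /pos e eqxx.
Qed.

Definition sep x y : seq (wall G) := [seq act x W | W <- Nw (x^-1 * y)].

Lemma crs1 W : crs W 1 = 0%R.
Proof. exact: coc1. Qed.

Lemma Nw_pos x W : (W \in Nw x) = (pos W x != pos W 1).
Proof. by rewrite pos_sep crs1 mem_Nw. Qed.

Lemma mem_sep x y W : (W \in sep x y) = (pos W x != pos W y).
Proof.
rewrite -{1}(actVK x W) mem_map; last exact: act_inj.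
by rewrite Nw_pos !posV mulVKg mulg1 eq_sym.
Qed.

Lemma uniq_sep x y : uniq (sep x y).
Proof. by rewrite map_inj_uniq ?uniq_Nw //; apply: act_inj. Qed.

Lemma size_sep x y : size (sep x y) = len S (x^-1 * y).
Proof. by rewrite size_map size_Nw. Qed.

(** Lengths count walls, and the walls of y are the symmetric difference of those of x and those
    between x and y; lengths add exactly when the two sets are disjoint. *)
Lemma precP x y :
  prec S x y <-> forall W, pos W x != pos W 1 -> pos W y = pos W x.
Proof.
have xor W : (W \in Nw y) = (W \in Nw x) (+) (W \in sep x y).
  by rewrite !Nw_pos mem_sep; case: (pos W x) (pos W y) (pos W 1) => -[] [].
rewrite /prec -(size_Nw x) -(size_Nw y) -size_sep -size_cat; split=> [e W|h].
  have : uniq (Nw x ++ sep x y).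
    apply: (@leq_size_uniq _ (Nw y)); [exact: uniq_Nw| |by rewrite e].
    by move=> V; rewrite xor mem_cat; case: (V \in Nw x).
  rewrite cat_uniq => /and3P[_ /hasPn h _]; rewrite -Nw_pos => Wx.
  apply/eqP; rewrite eq_sym -[_ == _]negbK -mem_sep; apply/negP => /h.
  by rewrite Wx.
apply/esym/perm_size/uniq_perm; first exact: uniq_Nw.
  rewrite cat_uniq uniq_Nw uniq_sep andbT /=; apply/hasPn => W;
    rewrite mem_sep Nw_pos.
  by apply: contraNN => /h ->.
move=> W; rewrite xor mem_cat; case: (boolP (W \in Nw x)) => //; rewrite Nw_pos => /h.
by rewrite mem_sep => ->; rewrite eqxx.
Qed.

Lemma letter_walls a : S a.1 -> Nw (letter_val a) =i [:: edge S a].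
Proof.
move=> Sa W; have -> : letter_val a = word_val [:: a]
  by rewrite word_val_cons word_val_nil mulg1.
by rewrite Nw_word //; apply/words_cons.
Qed.

Lemma letter_sep x a W : S a.1 ->
  (pos W x != pos W (x * letter_val a)) = (W == act x (edge S a)).
Proof.
move=> Sa; rewrite -mem_sep /sep mulKg -{1}(actVK x W) mem_map; last exact: act_inj.
by rewrite letter_walls // inE; apply/eqP/eqP => [<-|->]; rewrite ?actVK ?actK.
Qed.

Lemma letter_sep1 a W : S a.1 -> (pos W (letter_val a) != pos W 1) = (W == edge S a).
Proof. by move=> Sa; rewrite eq_sym -{1}(mul1g (letter_val a)) letter_sep // act1.
  Qed.

Lemma len1 : len S 1 = 0%N.
Proof. by rewrite -(word_val_nil G) len_word. Qed.

Lemma len_eq0 x : len S x = 0%N -> x = 1.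
Proof. by rewrite lenE -{2}(gd_val x) => /size0nil ->; rewrite word_val_nil. Qed.

Lemma len_letter a : S a.1 -> len S (letter_val a) = 1%N.
Proof.
move=> Sa; have -> : letter_val a = word_val [:: a]
  by rewrite word_val_cons word_val_nil mulg1.
by rewrite len_word //; apply/words_cons.
Qed.

Lemma first_letter x : x <> 1 ->
  exists a x', [/\ S a.1, x = letter_val a * x' & len S x = (len S x').+1].
Proof.
move=> x1; have := @gd_words x; have := uniq_gd x; have := gd_val x; have := lenE x.
case: (gd x) => [|a u] l v; first by case: x1; rewrite -v word_val_nil.
rewrite walls_cons /= map_inj_uniq; last exact: act_inj.
case/andP=> _ uu /words_cons[Sa Su].
by exists a, (word_val u); rewrite -word_val_cons v l len_word.
Qed.

Lemma last_letter x : x <> 1 ->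
  exists x' a, [/\ S a.1, x = x' * letter_val a & len S x = (len S x').+1].
Proof.
move=> x1; have := @gd_words x; have := uniq_gd x; have := gd_val x; have := lenE x.
elim/last_ind: (gd x) => [|u a _] l v; first by case: x1; rewrite -v word_val_nil.
rewrite -cats1 walls_cat cat_uniq => /and3P[uu _ _] /words_cat[Su /words_cons[Sa _]].
exists (word_val u), a; rewrite l -v -cats1 size_cat len_word // addn1; split=> //.
by rewrite word_val_cat word_val_cons word_val_nil mulg1.
Qed.

(* x belongs to the subgroup generated by T. *)
Definition gen (T : set G) x : Prop := forall W, W \in Nw x -> T W.1.

Lemma gen_word T x : gen T x <->
  exists u, [/\ words S u, forall a, a \in u -> T a.1 & word_val u = x].
Proof.
split=> [h|[u [Su Tu <-]] W].
  exists (gd x); split; [exact: gd_words| |exact: gd_val].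
  by move=> a /mem_walls_type[W Wx <-]; apply: h.
rewrite mem_Nw /crs -wsum_coc //; case: (boolP (W \in walls u)).
  by move=> /walls_type[a /Tu Ta ->].
move=> nW; rewrite wsum0 ?eqxx // => V Vu.
by rewrite /dirac; case: eqP => // e; rewrite -e Vu in nW.
Qed.

Lemma LkP s x : Lk S s x <-> gen (adj S s) x.
Proof.
rewrite gen_word; split=> [[u hu <-]|[u [Su hu <-]]]; exists u => //.
by split=> // a /hu [].
Qed.


Lemma prec_Nw x y W : prec S x y -> W \in Nw x -> W \in Nw y.
Proof. by rewrite !Nw_pos => /precP h Wx; rewrite (h _ Wx). Qed.

Lemma pos_edge a : S a.1 ->
  pos (edge S a) (letter_val a) = a.2 /\ pos (edge S a) 1 = ~~ a.2.
Proof.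
move=> Sa.
have e : crs (edge S a) (letter_val a) = sgn a.2.
  have -> : letter_val a = word_val [:: a]
    by rewrite word_val_cons word_val_nil mulg1.
  rewrite /crs -wsum_coc; last by apply/words_cons.
  by rewrite wsum_cons wsum_nil addr0 /dirac eqxx mulr1.
case ea : a.2 e => e.
  by have /pos_crs[-> /negbTE->] : (crs (edge S a) 1 < crs (edge S a) (letter_val
    a))%R
    by rewrite e crs1.
by have /pos_crs[-> /negbTE->] : (crs (edge S a) (letter_val a) < crs (edge S a) 1)%R
    by rewrite e crs1.
Qed.

Lemma pos_edge_act a x : S a.1 -> pos (act x (edge S a)) x = ~~ a.2.
Proof. by move=> /pos_edge[_ <-]; rewrite -{2}(mulg1 x) posM. Qed.

Lemma eq_pos x y : (forall W, pos W x = pos W y) -> x = y.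
Proof.
move=> h; suff : x^-1 * y = 1 by move/mulg1_eq; rewrite invgK.
apply: len_eq0; rewrite -size_sep; case e : (sep x y) => [|W l] //.
have : W \in sep x y by rewrite e mem_head.
by rewrite mem_sep h eqxx.
Qed.

Lemma prec_letter a x : S a.1 -> edge S a \in Nw x -> prec S (letter_val a) x.
Proof.
move=> Sa; rewrite Nw_pos => h; apply/precP => W.
rewrite letter_sep1 // => /eqP->; move: h; have [-> ->] := pos_edge Sa.
by case: (pos _ x) (a.2) => -[].
Qed.

Lemma len_letterM a x y : S a.1 -> act x (edge S a) \in sep x y ->
  len S (x^-1 * y) = (len S ((x * letter_val a)^-1 * y)).+1.
Proof.
move=> Sa; rewrite mem_map; last exact: act_inj.
move/(prec_letter Sa); rewrite /prec len_letter // add1n => <-.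
by rewrite invgM mulgA.
Qed.

Lemma sep_letter x y : x <> y -> exists2 a, S a.1 & act x (edge S a) \in sep x y.
Proof.
move=> xy; have : x^-1 * y <> 1 by move=> /mulg1_eq; rewrite invgK.
case/first_letter => a [x' [Sa e l]]; exists a => //.
rewrite mem_map; last exact: act_inj.
apply: (@prec_Nw (letter_val a)); last by rewrite letter_walls // inE.
by rewrite /prec l len_letter // e mulKg.
Qed.

Lemma Nw1 : Nw 1 = [::].
Proof. by apply/size0nil; rewrite size_Nw len1. Qed.

(* Compare the last letters of x and y across the common wall: the parts before
   them lie in the link of that letter, which then comes first. *)
Lemma Nw_disjoint x y :
  (forall a, S a.1 -> edge S a \in Nw x -> edge S a \in Nw y -> False) ->
  forall W, W \in Nw x -> W \in Nw y -> False.
Proof.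
have [n] := ubnP (len S x + len S y); elim: n => // n IH in x y *.
rewrite ltnS => lxy h W Wx Wy.
have [x1 y1] : x <> 1 /\ y <> 1.
  by split=> e; [move: Wx|move: Wy]; rewrite e Nw1.
have [x' [b [Sb ex lx]]] := last_letter x1.
have [y' [c [Sc ey ly]]] := last_letter y1.
have px : prec S x' x by rewrite /prec lx {1}ex mulKg len_letter // addn1.
have py : prec S y' y by rewrite /prec ly {1}ey mulKg len_letter // addn1.
have Dx V : V \in Nw x' -> V \in Nw y -> False.
  apply: IH; first by move: lxy; rewrite lx; lia.
  by move=> a Sa /(prec_Nw px); apply: h.
have Dy V : V \in Nw x -> V \in Nw y' -> False.
  apply: IH; first by move: lxy; rewrite ly; lia.
  by move=> a Sa ax /(prec_Nw py); apply: h.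
have Wx' : W \notin Nw x' by apply/negP => /Dx; apply.
have Wy' : W \notin Nw y' by apply/negP => /Dy; apply.
have eWx : W = act x' (edge S b).
  apply/eqP; rewrite -letter_sep // -ex; move: Wx' Wx;
    rewrite !Nw_pos negbK => /eqP->.
  by rewrite eq_sym.
have eWy : W = act y' (edge S c).
  apply/eqP; rewrite -letter_sep // -ey; move: Wy' Wy;
    rewrite !Nw_pos negbK => /eqP->.
  by rewrite eq_sym.
have bc : b = c.
  rewrite (surjective_pairing b) (surjective_pairing c); congr pair.
    by rewrite -(edge1 S b) -(edge1 S c) -[LHS]/((act x' _).1) -eWx eWy.
  apply: negb_inj; rewrite -(pos_edge_act x' Sb) -(pos_edge_act y' Sc) -eWx -eWy.
  by move: Wx' Wy'; rewrite !Nw_pos !negbK => /eqP-> /eqP->.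
(* By induction no wall of [x'] is a wall of [y'], so all of them separate [x'] from [y']; and x'^-1
   y' stabilises the wall of [b], hence lies in its link subgroup. *)
have hL : Lk S b.1 x'.
  have : act (x'^-1 * y') (edge S b) = edge S b.
    by rewrite actM {1}bc -eWy eWx actK.
  move/act_edge/LkP => hg; apply/LkP => V Vx'.
  have -> : V.1 = (act x'^-1 V).1 by [].
  apply: hg; rewrite -(mem_map (@act_inj _ x')) actVK -/(sep x' y') mem_sep.
  have := Vx'; rewrite Nw_pos => /negbTE.
  have : V \notin Nw y' by apply/negP => /(prec_Nw py) /Dx; apply.
  by rewrite Nw_pos negbK => /eqP-> ->.
move/act_edge: hL => hL; rewrite hL in eWx.
by apply: (h b Sb); rewrite -eWx.
Qed.

(** * Medians and intervals by majority vote *)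

Definition maj (a b c : bool) : bool := (a && b) || (b && c) || (a && c).

(** Common first letters are stripped off; when none is left, x and y have no common wall and 1 is
    their median with 1. *)
Lemma median_ex1 x y : exists z, forall W,
  pos W z = maj (pos W 1) (pos W x) (pos W y).
Proof.
have [n] := ubnP (len S x + len S y); elim: n => // n IH in x y *.
rewrite ltnS => lxy.
case: (pselect (exists2 a, S a.1 & edge S a \in Nw x /\ edge S a \in Nw y)) =>
  [[a Sa [ax ay]]|h].
  have px := prec_letter Sa ax; have py := prec_letter Sa ay.
  have [|z hz] := IH ((letter_val a)^-1 * x) ((letter_val a)^-1 * y).
    by move: lxy; rewrite -px -py len_letter //; lia.
  exists (letter_val a * z) => W; rewrite -posV hz !posV !mulVKg mulg1.
  case: (boolP (W == edge S a)) => [/eqP->|]; last first.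
    by rewrite -letter_sep1 // negbK => /eqP->.
  have [-> ->] := pos_edge Sa; move: ax ay; rewrite !Nw_pos.
  by have [_ ->] := pos_edge Sa; case: (pos _ x) (pos _ y) (a.2) => -[] [].
exists 1 => W; have : W \in Nw x -> W \in Nw y -> False.
  by apply: Nw_disjoint => a Sa ax ay; apply: h; exists a.
rewrite !Nw_pos.
by case: (pos _ x) (pos _ y) (pos _ 1) => -[] [] // /(_ isT isT).
Qed.

Lemma prec_anti x y : prec S x y -> prec S y x -> x = y.
Proof.
move=> /precP h1 /precP h2; apply: eq_pos => W; have := h1 W; have := h2 W.
by case: (pos W x) (pos W y) (pos W 1) => -[] [] //= h3 h4;
  solve [exact: (h3 isT) | exact: (h4 isT) | exact: esym (h4 isT)].
Qed.

Lemma meetE x y W : pos W (meet S x y) = maj (pos W 1) (pos W x) (pos W y).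
Proof.
have [z hz] := median_ex1 x y.
have gz : is_glb S x y z.
  split=> [||t /precP h1 /precP h2]; apply/precP => V; rewrite ?hz.
  - by case: (pos V x) (pos V y) (pos V 1) => -[] [].
  - by case: (pos V x) (pos V y) (pos V 1) => -[] [].
  have := h1 V; have := h2 V.
  by case: (pos V x) (pos V y) (pos V 1) (pos V t) => -[] [] [] //=;
    move=> h3 h4 h5; rewrite ?h3 ?h4.
have gm : is_glb S x y (meet S x y) by apply: xgetPex; exists z.
suff -> : meet S x y = z by rewrite hz.
by case: gm => a1 a2 a3; case: gz => b1 b2 b3; apply: prec_anti;
  [apply: b3|apply: a3].
Qed.

Lemma YE x y z W : pos W (Y S x y z) = maj (pos W x) (pos W y) (pos W z).
Proof. by rewrite /Y -posV meetE !posV mulg1 !mulVKg. Qed.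

Lemma intervalP x y z :
  interval S x y z <-> forall W, pos W x = pos W y -> pos W z = pos W x.
Proof.
rewrite /interval /mkset precP; split=> h W.
  have := h (act x^-1 W); rewrite !posV mulg1 !mulVKg => {}h e.
  by apply/eqP; rewrite -[_ == _]negbK; apply/negP => zx; move: (zx);
    rewrite -(h zx) e eqxx.
rewrite -(actK x W) !posV !mulVKg mulg1; have := h (act x W).
by case: (pos _ x) (pos _ y) (pos _ z) => -[] [] //= h3 _;
  solve [exact: (h3 erefl) | exact: esym (h3 erefl)].
Qed.

(** * Transverse walls *)

Definition transverse W V : Prop :=
  forall b c, exists x, pos W x = b /\ pos V x = c.

Lemma single_wall x y W : x <> y -> (forall V, V \in sep x y -> V = W) ->
  exists a, [/\ S a.1, y = x * letter_val a & W = act x (edge S a)].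
Proof.
move=> /sep_letter[a Sa ha] h; have e := h _ ha; exists a; split=> //.
apply: eq_pos => V; have := letter_sep x V Sa; have := h V; rewrite e mem_sep.
move: ha; rewrite e !mem_sep; case: (eqVneq V W) => [->|VW].
  by case: (pos W x) (pos W y) (pos W (x * letter_val a)) => -[] [] //=.
by case: (pos V x) (pos V y) (pos V (x * letter_val a)) => -[] [] //= _ h1 _;
  move: VW; rewrite h1 // eqxx.
Qed.

(* At a closest pair of points in opposite quadrants, the two walls bound a
   square. *)
Lemma transverse_adj W V : transverse W V -> adj S W.1 V.1.
Proof.
move=> tr; have [p0 [Wp0 Vp0]] := tr false false; have [q [Wq Vq]] := tr true true.
have [n] := ubnP (len S (p0^-1 * q)).
elim: n p0 Wp0 Vp0 => // n IH p Wp Vp; rewrite ltnS => lpq.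
(* For [m] between [p] and [q], the first letter from [p] towards [m] crosses W or V; otherwise it
   leads to a point of the same quadrant closer to [q], and induction applies. *)
have step m : (forall U, pos U p = pos U q -> pos U m = pos U p) -> m <> p ->
    exists a, [/\ S a.1, act p (edge S a) \in sep p m &
      (adj S W.1 V.1) \/ act p (edge S a) = W \/ act p (edge S a) = V].
  move=> hm mp; have [a Sa ha] := sep_letter (nesym mp); exists a; split=> //.
  have hq : act p (edge S a) \in sep p q.
    by apply: contraTT ha; rewrite !mem_sep !negbK => /eqP/hm ->.
  case: (eqVneq (act p (edge S a)) W) => [|aW]; first by right; left.
  case: (eqVneq (act p (edge S a)) V) => [|aV]; first by right; right.
  have side U : act p (edge S a) != U -> pos U (p * letter_val a) = pos U p.
    by rewrite eq_sym -letter_sep // negbK => /eqP.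
  left; apply: (IH (p * letter_val a)); rewrite ?side //.
  by move: lpq; rewrite (len_letterM Sa hq).
have [r [Wr Vr]] := tr false true; have [r' [Wr' Vr']] := tr true false.
have hY z U : pos U p = pos U q -> pos U (Y S p q z) = pos U p.
  by move=> e; rewrite YE -e; case: (pos U p) (pos U z) => -[].
(* The median with [r] is separated from [p] by V but not by W, so this letter crosses V; with [r']
   the roles are exchanged. *)
have [|a [Sa ha [//|hV]]] := step _ (hY r).
  by move/(congr1 (pos V)); rewrite YE Vp Vq Vr.
have {}hV : act p (edge S a) = V.
  by case: hV => // e; move: ha; rewrite e mem_sep YE Wp Wq Wr.
have [|b [Sb hb [//|hW]]] := step _ (hY r').
  by move/(congr1 (pos W)); rewrite YE Wp Wq Wr'.
have {}hW : act p (edge S b) = W.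
  by case: hW => // e; move: hb; rewrite e mem_sep YE Vp Vq Vr'.
have WV : W <> V by move=> e; move: Wr Vr; rewrite e => ->.
have a2 : a.2 = true by apply: negb_inj; rewrite -(pos_edge_act p Sa) hV.
have b2 : b.2 = true by apply: negb_inj; rewrite -(pos_edge_act p Sb) hW.
have sa U : pos U (p * letter_val a) = (U == V) (+) pos U p.
  by rewrite -hV -letter_sep //; case: (pos U p) (pos U (p * letter_val a)) => -[].
have sb U : pos U (p * letter_val b) = (U == W) (+) pos U p.
  by rewrite -hW -letter_sep //; case: (pos U p) (pos U (p * letter_val b)) => -[].
(* The fourth corner of the square at [p]: it differs from [p] at W and V only, and reading it along
   both sides gives the commutation. *)
set m := Y S (p * letter_val a) (p * letter_val b) q.
have hm U : pos U m = if (U == W) || (U == V) then true else pos U p.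
  rewrite YE sa sb; case: (eqVneq U W) => [->|UW] /=.
    by rewrite (introF eqP WV) Wp Wq.
  case: (eqVneq U V) => [->|UV] /=; first by rewrite Vp Vq.
  by case: (pos U p) (pos U q) => -[].
have corner (c d : G * bool) U U' : U <> U' -> pos U p = false -> pos U' p = false ->
    (forall T, pos T m = if (T == U) || (T == U') then true else pos T p) ->
    (forall T, pos T (p * letter_val c) = (T == U') (+) pos T p) ->
    exists2 e, S e & m = p * letter_val c * e /\ U.1 = e.
  move=> UU Up Up' hm' sc.
  have [||e [Se me Ue]] := @single_wall (p * letter_val c) m U.
  - by move/(congr1 (pos U)); rewrite hm' eqxx sc Up (introF eqP UU).
  - move=> T; rewrite mem_sep hm' sc; case: (eqVneq T U) => //= TU.
    by case: (eqVneq T U') => [->|_]; rewrite ?Up' ?eqxx //= eqxx.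
  have e2 : e.2 = true.
    apply: negb_inj; rewrite -(pos_edge_act (p * letter_val c) Se) -Ue sc Up.
    by rewrite (introF eqP UU).
  exists e.1 => //; split; last by rewrite Ue /= edge1.
  by rewrite me /letter_val e2.
have [e Se [me We]] := corner a b W V WV Wp Vp hm sa.
have [|f Sf [mf Vf]] := corner b a V W (nesym WV) Vp Wp _ sb.
  by move=> T; rewrite orbC hm.
have Wb : W.1 = b.1 by rewrite -hW /= edge1.
have Va : V.1 = a.1 by rewrite -hV /= edge1.
rewrite Wb Va; split=> //.
  move=> ab; apply: WV; rewrite -hW -hV; congr (act _ (edge _ _)).
  by rewrite (surjective_pairing b) (surjective_pairing a) ab a2 b2.
move: mf; rewrite me -We -Vf Wb Va /letter_val a2 b2 -!mulgA => /mulgI.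
by move->.
Qed.

Lemma Nw_sep x W : (W \in Nw x) = (W \in sep 1 x).
Proof. by rewrite mem_sep Nw_pos eq_sym. Qed.

Lemma sepM x y W : (W \in sep x (x * y)) = (act x^-1 W \in Nw y).
Proof. by rewrite mem_sep Nw_pos !posV mulg1 eq_sym. Qed.

(** * Supports *)

Definition supp x : set G := [set s | exists2 W, W \in Nw x & W.1 = s].

Lemma genP (T : set G) x : gen T x <-> supp x `<=` T.
Proof.
split=> [h s [W Wx <-]|h W Wx]; first exact: h.
by apply: h; exists W.
Qed.

Lemma gen1 (T : set G) : gen T 1.
Proof. by move=> W; rewrite Nw1. Qed.

Lemma genM (T : set G) x y : gen T x -> gen T y -> gen T (x * y).
Proof.
move=> hx hy W; rewrite Nw_sep mem_sep => h.
case: (boolP (W \in Nw x)) => [/hx //|]; rewrite Nw_pos negbK => /eqP e.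
have : act x^-1 W \in Nw y by rewrite Nw_pos !posV mulg1 e eq_sym.
by move/hy.
Qed.

Lemma genV (T : set G) x : gen T x -> gen T x^-1.
Proof.
move=> hx W; rewrite Nw_pos => h.
have : act x W \in Nw x by rewrite Nw_pos !pos_act mulVg mulg1 eq_sym.
by move/hx.
Qed.

Lemma genX (T : set G) x n : gen T x -> gen T (x ^+ n).
Proof.
by move=> hx; elim: n => [|n IH]; [apply: gen1|rewrite expgS; apply: genM].
Qed.

Lemma gen_supp x : gen (supp x) x.
Proof. by move=> W Wx; exists W. Qed.

Lemma suppX x n : supp (x ^+ n) `<=` supp x.
Proof. by apply/genP; apply: genX; apply: gen_supp. Qed.

Lemma suppV x : supp x^-1 = supp x.
Proof.
apply/seteqP; split; apply/genP; first by apply: genV; apply: gen_supp.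
by rewrite -{2}(invgK x); apply: genV; apply: gen_supp.
Qed.

Lemma supp_neq1 x : x <> 1 -> exists s, supp x s.
Proof.
move=> /first_letter[a [x' [Sa e l]]]; exists a.1, (edge S a); last by rewrite edge1.
apply: (@prec_Nw (letter_val a)); last by rewrite letter_walls // inE.
by rewrite /prec l len_letter // e mulKg.
Qed.

Lemma supp1 s : ~ supp 1 s.
Proof. by case=> W; rewrite Nw1. Qed.

Definition csupp x y : Prop := forall s t, supp x s -> supp y t -> adj S s t.

Lemma csupp_sym x y : csupp x y -> csupp y x.
Proof. by move=> h s t hs ht; apply/adj_sym/h. Qed.

Lemma adj_irr s : ~ adj S s s.
Proof. by case=> _ _; case. Qed.

Lemma commute_words u v : (forall a b, a \in u -> b \in v -> adj S a.1 b.1) ->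
  commute (word_val u) (word_val v).
Proof.
move=> h; apply: commute_sym; elim: u h => [|a u IH] h.
  by rewrite word_val_nil; apply: commute1.
rewrite word_val_cons; apply: commuteM; last first.
  by apply: IH => c d cu; apply: h; rewrite inE cu orbT.
apply: commute_sym; elim: v h {IH} => [|b v IH] h.
  by rewrite word_val_nil; apply: commute1.
rewrite word_val_cons; apply: commuteM; last first.
  by apply: IH => c d cu dv; apply: h; rewrite // inE dv orbT.
have [_ _ _ c] := h a b (mem_head _ _) (mem_head _ _).
rewrite /letter_val; case: (a.2); case: (b.2) => //.
- exact: commuteV.
- by apply: commute_sym; apply: commuteV.
- by apply: commuteV; apply: commute_sym; apply: commuteV.
Qed.

Lemma gd_supp x a : a \in gd x -> supp x a.1.
Proof. by move=> /mem_walls_type[W Wx Wa]; exists W. Qed.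

Lemma csupp_commute x y : csupp x y -> commute x y.
Proof.
move=> h; rewrite -(gd_val x) -(gd_val y); apply: commute_words => a b ax yb.
by apply: h; apply: gd_supp.
Qed.

(** At the edge where y crosses W, x commutes with the prefix and lies in the link subgroup of the
    letter. *)
Lemma csupp_fix x y W : csupp x y -> W \in Nw y -> act x W = W.
Proof.
move=> h /mem_walls[u1 [b [u2 [e ->]]]].
have hb : supp y b.1 by apply: gd_supp; rewrite e mem_cat mem_head orbT.
have c : commute x (word_val u1).
  rewrite -(gd_val x); apply: commute_words => a c ax cu.
  by apply: h; apply: gd_supp; rewrite // e mem_cat cu.
rewrite -actM c actM; congr act; apply/act_edge/LkP => V Vx.
by apply/adj_sym/h => //; exists V.
Qed.

Lemma csuppM_Nw x y W : csupp x y ->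
  (W \in Nw (x * y)) = (W \in Nw x) || (W \in Nw y).
Proof.
move=> h; have e : (W \in Nw y) = (W \in sep x (x * y)).
  rewrite sepM; apply/idP/idP => Wy; first by rewrite -(csupp_fix h Wy) actK.
  by rewrite -(actVK x W) (csupp_fix h Wy).
have : W \in Nw x -> W \in Nw y -> False.
  move=> Wx Wy; apply: (@adj_irr W.1); apply: h; exists W => //.
rewrite e !Nw_pos mem_sep.
by case: (pos W x) (pos W (x * y)) (pos W 1) => -[] [] //= /(_ isT isT).
Qed.

Lemma csupp_Nw_disjoint x y W : csupp x y -> W \in Nw x -> W \in Nw y -> False.
Proof. by move=> h Wx Wy; apply: (@adj_irr W.1); apply: h; exists W. Qed.

Lemma suppM x y : csupp x y -> supp (x * y) = supp x `|` supp y.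
Proof.
move=> h; apply/seteqP; split=> [s [W]|s].
  by rewrite csuppM_Nw // => /orP[] ? <-; [left|right]; exists W.
by case=> -[W hW <-]; exists W; rewrite // csuppM_Nw // hW ?orbT.
Qed.

(** * Nested walls *)

Lemma transverseI W V x y z t :
  pos W x = pos W y -> pos W z = pos W t -> pos W x != pos W z ->
  pos V x = pos V z -> pos V y = pos V t -> pos V x != pos V y ->
  transverse W V.
Proof.
move=> e1 e2 n1 e3 e4 n2 b c.
case: (pos W x =P b) => hb; case: (pos V x =P c) => hc.
- by exists x.
- exists y; rewrite -e1; split=> //.
  by move: n2 hc; case: (pos V x) (pos V y) c => -[] [].
- exists z; rewrite -e3; split=> //.
  by move: n1 hb; case: (pos W x) (pos W z) b => -[] [].
- exists t; rewrite -e2 -e4; split.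
    by move: n1 hb; case: (pos W x) (pos W z) b => -[] [].
  by move: n2 hc; case: (pos V x) (pos V y) c => -[] [].
Qed.

Lemma same_type_nested W V : W.1 = V.1 ->
  exists b c, forall x, pos W x = b -> pos V x = c.
Proof.
move=> e; apply: contrapT => h; apply: (@adj_irr W.1); rewrite {2}e.
apply: transverse_adj => b c; apply: contrapT => h1; apply: h.
exists b, (~~ c) => x xb; case: (boolP (pos V x == c)) => [/eqP xc|].
  by case: h1; exists x.
by case: (pos V x) c {h1} => -[].
Qed.

(* With H = {x | pos W x = b}: sub g W b says that g H is contained in H, and
   disj g W b that g H is disjoint from H.  A wall is called nonper, that is not
   peripheral, for g when g or g^-1 maps one of its sides into itself. *)
Definition sub g W b : Prop := forall x, pos W x = b -> pos W (g * x) = b.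
Definition disj g W b : Prop := forall x, pos W x = b -> pos W (g * x) = ~~ b.
Definition nonper g W : Prop := sub g W true \/ sub g W false.

Lemma nonperI g W b : sub g W b -> nonper g W.
Proof. by case: b; [left|right]. Qed.

Lemma subV g W b : sub g W b -> sub g^-1 W (~~ b).
Proof.
move=> h x xb; case: (boolP (pos W (g^-1 * x) == b)) => [/eqP/h|].
  by rewrite mulVKg xb; case: b {h xb}.
by case: (pos W _) b {h xb} => -[].
Qed.

Lemma disjV g W b : disj g W b -> disj g^-1 W b.
Proof.
move=> h x xb; case: (boolP (pos W (g^-1 * x) == b)) => [/eqP/h|].
  by rewrite mulVKg xb; case: b {h xb}.
by case: (pos W _) b {h xb} => -[].
Qed.

Lemma nonper_disj g W : nonper g W \/ exists b, disj g W b.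
Proof.
have [b [c h]] := @same_type_nested (act g W) W erefl.
have {}h x : pos W x = b -> pos W (g * x) = c by rewrite -{1}(posM g); apply: h.
case: (boolP (b == c)) => [/eqP e|ne]; last first.
  by right; exists b => x /h ->; case: b c ne {h} => -[].
by left; apply: (@nonperI _ _ b) => x /h; rewrite e.
Qed.

Lemma subM g h W b : sub g W b -> sub h W b -> sub (g * h) W b.
Proof. by move=> hg hh x /hh /hg; rewrite mulgA. Qed.

Lemma subX g W b n : sub g W b -> sub (g ^+ n) W b.
Proof.
move=> h; elim: n => [|n IH]; last by rewrite expgS; apply: subM.
by move=> x; rewrite mul1g.
Qed.

(** The type [wall] contains arbitrary pairs; this singles out the genuine walls, the translates of
    edges. *)
Definition isw W : Prop := exists x y, pos W x != pos W y.

Lemma isw_side W b : isw W -> exists x, pos W x = b.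
Proof.
case=> x [y h]; case: (boolP (pos W x == b)) => [/eqP|n]; first by exists x.
by exists y; move: h n; case: (pos W x) (pos W y) b => -[] [].
Qed.

Lemma isw_act g W : isw W -> isw (act g W).
Proof. by case=> x [y h]; exists (g * x), (g * y); rewrite !posM. Qed.

Lemma isw_edge W : isw W -> exists g a, S a.1 /\ W = act g (edge S a).
Proof.
case=> x [y]; rewrite -mem_sep => /mapP[V /mem_walls[u1 [b [u2 [e ->]]]] ->].
exists (x * word_val u1), b; rewrite actM; split=> //.
by apply: (@gd_words (x^-1 * y)); rewrite e mem_cat mem_head orbT.
Qed.

(** W has u^-1 and 1 on one side, u and u^2 on the other. Of the possible nestings of W with its
    translate by u, these positions leave only the one where u pushes the side of u into itself. *)
Lemma reduced_sub (u : G) W : (forall V, V \in Nw u -> V \in Nw u^-1 -> False) ->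
  W \in Nw u -> sub u W (pos W u).
Proof.
move=> h Wu; have Wu' : W \notin Nw u^-1 by apply/negP; apply: h.
set b := pos W u; have W1 : pos W 1 = ~~ b.
  by move: Wu; rewrite Nw_pos -/b; case: b (pos W 1) => -[].
have WV : pos W u^-1 = ~~ b by move: Wu'; rewrite Nw_pos negbK W1 => /eqP.
have W2 : pos W (u * u) = b.
  apply/eqP; apply: contraT => ne; case: (h (act u^-1 W)).
    by rewrite Nw_pos !posV mulg1.
  by rewrite Nw_pos !posV mulg1 mulgV W1 -/b; case: (b).
have [c [d hd]] := @same_type_nested (act u W) W erefl.
have {}hd x : pos W x = c -> pos W (u * x) = d by rewrite -{1}(posM u); apply: hd.
have h1 := hd 1; rewrite mulg1 W1 -/b in h1.
have hu := hd u; rewrite W2 -/b in hu.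
have hV := hd u^-1; rewrite mulgV W1 WV in hV.
have cb : c = b.
  case: (c =P b) => // cb; have e : ~~ b = c by case: (b) (c) cb => -[].
  by have := h1 e; rewrite -(hV e); case: (b).
by move: hd; rewrite cb -(hu (esym cb)).
Qed.

(** * Roots *)

Lemma reduced_powP (u : G) W k : (forall V, V \in Nw u -> V \in Nw u^-1 -> False) ->
  (0 < k)%N -> W \in Nw u -> W \in Nw (u ^+ k).
Proof.
move=> h; case: k => // k _ Wu; have := subX k (reduced_sub h Wu) erefl.
by rewrite -expgSr Nw_pos => ->; rewrite -Nw_pos.
Qed.

(* By induction on the length of u: either u is cyclically reduced, or
   u = a u' a^-1 for a letter a. *)
Lemma supp_first_pow (u : G) k : (0 < k)%N ->
  supp u `<=` supp (u ^+ k) /\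
  forall a, S a.1 -> edge S a \in Nw (u ^+ k) -> edge S a \in Nw u.
Proof.
move=> k0; have [n] := ubnP (len S u); elim: n u => // n IH u; rewrite ltnS => lu.
case: (pselect (exists a, [/\ S a.1, edge S a \in Nw u & edge S a \in Nw u^-1]));
  last first.
  move=> no; have h V : V \in Nw u -> V \in Nw u^-1 -> False.
    by apply: Nw_disjoint => a Sa a1 a2; apply: no; exists a.
  have hk W : W \in Nw u -> W \in Nw (u ^+ k) by apply: reduced_powP.
  split=> [s [W Wu <-]|a Sa ak]; first by exists W => //; apply: hk.
  apply: contraT => au; have [W0 W0u e] : supp u (edge S a).1.
    by apply: (@suppX u k); exists (edge S a).
  have ne : W0 != edge S a by apply: contraNneq au => <-.
  exfalso; apply: (@adj_irr W0.1); rewrite {2}e; apply: transverse_adj.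
  have W0k := hk _ W0u.
  (* [W0] separates 1 and the letter from u and u^k, while [edge S a] separates 1 and u from the
     letter and u^k: two walls of the same type would be transverse. *)
  apply: (@transverseI _ _ 1 (letter_val a) u (u ^+ k)).
  - by apply/eqP; move: ne; rewrite -letter_sep1 // negbK eq_sym.
  - by move: W0u W0k; rewrite !Nw_pos;
    case: (pos W0 u) (pos W0 1) (pos W0 (u ^+ k)) => -[] [].
  - by move: W0u; rewrite Nw_pos eq_sym.
  - by move: au; rewrite Nw_pos negbK eq_sym => /eqP.
  - have := letter_sep1 (edge S a) Sa; rewrite eqxx; move: ak; rewrite Nw_pos.
    by case: (pos _ (u ^+ k)) (pos _ 1) (pos _ (letter_val a)) => -[] [].
  - by have := letter_sep1 (edge S a) Sa; rewrite eqxx eq_sym.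
case=> a [Sa Eu EV]; set E := edge S a in Eu EV; set l := letter_val a.
have lE : forall V, (pos V l != pos V 1) = (V == E) by move=> V; apply: letter_sep1.
have lxE x V : (pos V x != pos V (x * l)) = (V == act x E) by apply: letter_sep.
have uE : act u E <> E.
  by move=> e; move: Eu; rewrite Nw_pos -{1}e -{2}(mulg1 u) posM eqxx.
have uEu : act u E \in Nw u.
  by move: EV; rewrite !Nw_pos !pos_act mulg1 mulVg eq_sym.
(* The conjugate [u'] loses at least the wall E and gains none, so it is shorter than u. *)
have inner V : V \in sep l (u * l) -> [/\ V \in Nw u, V != E & V != act u E].
  rewrite mem_sep => hV.
  have VE : V != E.
    apply/eqP => e; move: hV; rewrite e; have := lE E; rewrite eqxx.
    have := lxE u E; rewrite (introF eqP (nesym uE)); move: Eu; rewrite Nw_pos.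
    by case: (pos E u) (pos E 1) (pos E l) (pos E (u * l)) => -[] [] [].
  have VuE : V != act u E.
    apply/eqP => e; move: hV; rewrite e; have := lE (act u E);
      rewrite (introF eqP uE).
    have := lxE u (act u E); rewrite eqxx; move: uEu; rewrite Nw_pos.
    by case: (pos (act u E) u) (pos (act u E) 1) (pos (act u E) l)
      (pos (act u E) (u * l)) => -[] [] [].
  split=> //; rewrite Nw_pos; have := lE V; have := lxE u V.
  rewrite (negbTE VE) (negbTE VuE); move: hV.
  by case: (pos V u) (pos V 1) (pos V l) (pos V (u * l)) => -[] [] [].
set u' := l^-1 * u * l.
have lu' : (len S u' < n)%N.
  apply: leq_trans lu; rewrite /u' -mulgA -size_sep -(size_Nw u).
  apply: (@uniq_leq_size _ (E :: sep l (u * l))).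
    by rewrite /= uniq_sep andbT; apply/negP => /inner[]; rewrite eqxx.
  by move=> V; rewrite inE => /orP[/eqP->|/inner[]].
(* Both claims are needed for [u']: the one on first letters shows that E does not separate l from
   u^k l, the one on supports that u^k cannot fix E. Hence u^k crosses E. *)
have [IH1 IH2] := IH u' lu'.
have lu'E : l * u' = u * l by rewrite /u' -!mulgA mulVKg.
have inner' V : V \in Nw u' -> act l V \in sep l (u * l).
  by move=> Vu; rewrite -lu'E sepM actK.
set q := u' ^+ k.
have lqE : l * q = u ^+ k * l.
  have e : u' = u ^ l by rewrite conjgE mulgA.
  by rewrite /q e -conjXg conjgE mulVKg.
have outer V : V \in Nw q = (act l V \in sep l (u ^+ k * l))
  by rewrite -lqE sepM actK.
have EN : act l^-1 E = edge S (a.1, ~~ a.2) by rewrite edgeN -surjective_pairing.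
have E_out : E \notin sep l (u ^+ k * l).
  apply/negP; rewrite -{1}(actVK l E) -outer EN => /IH2 /= /(_ Sa).
  by rewrite -EN => /inner'; rewrite actVK => /inner[_]; rewrite eqxx.
have ukE : act (u ^+ k) E <> E.
  move=> e; apply: uE.
  have /act_edge/LkP /= hq : act q (edge S (a.1, ~~ a.2)) = edge S (a.1, ~~ a.2).
    by rewrite -EN -actM; apply: (@act_inj _ l); rewrite -actM mulgA lqE mulgK actVK.
  have /LkP hu' : gen (adj S a.1) u'.
    by move=> V Vu; apply: (iffLR (genP _ _) hq); apply: IH1; exists V.
  have /act_edge : Lk S (a.1, ~~ a.2).1 u' by [].
  by move/(congr1 (act l)); rewrite -EN -!actM mulgV act1 lu'E mulgK.
have Ek : E \in Nw (u ^+ k).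
  move: E_out; rewrite mem_sep Nw_pos negbK; have := lE E; rewrite eqxx.
  have := lxE (u ^+ k) E; rewrite (introF eqP (nesym ukE)).
  by case: (pos E (u ^+ k)) (pos E 1) (pos E l) (pos E (u ^+ k * l)) => -[] [] [].
have mid V : V \in sep l (u ^+ k * l) -> V.1 <> a.1 -> V \in Nw (u ^+ k).
  move=> + t; have VE : V != E by apply/eqP => e; apply: t; rewrite e edge1.
  have VuE : V != act (u ^+ k) E by apply/eqP => e; apply: t; rewrite e /= edge1.
  rewrite mem_sep Nw_pos; have := lE V; have := lxE (u ^+ k) V.
  rewrite (negbTE VE) (negbTE VuE).
  by case: (pos V (u ^+ k)) (pos V 1) (pos V l) (pos V (u ^+ k * l)) => -[] [] [].
split=> [s [W Wu <-]|b Sb bk].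
  have ha : supp (u ^+ k) a.1 by exists E => //; rewrite /E edge1.
  case: (W.1 =P a.1) => [-> //|t].
  have : act l^-1 W \in Nw u'.
    rewrite -sepM lu'E mem_sep.
    have VE : W != E by apply/eqP => e; apply: t; rewrite e /E edge1.
    have VuE : W != act u E by apply/eqP => e; apply: t; rewrite e /= /E edge1.
    have := lE W; have := lxE u W; move: Wu; rewrite (negbTE VE) (negbTE VuE) Nw_pos.
    by case: (pos W u) (pos W 1) (pos W l) (pos W (u * l)) => -[] [] [].
  move=> hW; have [V Vq e] : supp q W.1 by apply: IH1; exists (act l^-1 W).
  by exists (act l V) => //; apply: mid; rewrite -?outer //= e.
set V := edge S b in bk *; case: (eqVneq V E) => [->//|VE].
(* Two distinct first letters of u^k are adjacent, so [l] fixes the wall of [b], which is therefore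
   also a first wall of the conjugated power [q]. *)
have ba : adj S b.1 a.1.
  rewrite -(edge1 S b) -(edge1 S a); apply: transverse_adj.
  have lb U : (pos U (letter_val b) != pos U 1) = (U == V) by apply: letter_sep1.
  apply: (@transverseI _ _ 1 l (letter_val b) (u ^+ k)); rewrite -/V -/E.
  - by apply/esym/eqP; rewrite -[_ == _]negbK lE (negbTE VE).
  - have := lb V; move: bk; rewrite eqxx Nw_pos.
    by case: (pos V _) (pos V 1) (pos V (u ^+ k)) => -[] [].
  - by have := lb V; rewrite eqxx eq_sym.
  - by apply/esym/eqP; rewrite -[_ == _]negbK lb eq_sym (negbTE VE).
  - have := lE E; move: Ek; rewrite eqxx Nw_pos.
    by case: (pos E l) (pos E 1) (pos E (u ^+ k)) => -[] [].
  - by have := lE E; rewrite eqxx eq_sym.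
have lV : act l V = V.
  apply/act_edge; have := Lk_adj a.2 ba.
  by rewrite -surjective_pairing.
have : V \in Nw q.
  rewrite outer lV mem_sep; have := lE V; rewrite (negbTE VE).
  have : V != act (u ^+ k) E.
    apply/eqP => /(congr1 fst) /=; rewrite /V /E !edge1 => e.
    by apply: (@adj_irr a.1); rewrite -{1}e.
  have := lxE (u ^+ k) V; move: bk; rewrite Nw_pos => + + /negbTE e3; rewrite e3.
  by case: (pos V (u ^+ k)) (pos V 1) (pos V l) (pos V (u ^+ k * l)) => -[] [] [].
by move=> /(IH2 _ Sb) /inner'; rewrite lV => /inner[].
Qed.

Lemma supp_pow (u : G) k : (0 < k)%N -> supp (u ^+ k) = supp u.
Proof.
move=> k0; apply/seteqP; split; first exact: suppX.
by have [] := supp_first_pow u k0.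
Qed.

(** After conjugation the stabiliser is a link subgroup; belonging to it depends on the support
    only, which is the same for an element and its positive powers. *)
Lemma pow_fix (u : G) k W : isw W -> (0 < k)%N -> act (u ^+ k) W = W -> act u W = W.
Proof.
move=> /isw_edge[g [a [Sa ->]]] k0 e.
have /act_edge/LkP/genP : act ((u ^ g) ^+ k) (edge S a) = edge S a.
  by rewrite -conjXg conjgE !actM e actK.
rewrite supp_pow // => /genP/LkP/act_edge.
by rewrite conjgE !actM => /(congr1 (act g)); rewrite actVK.
Qed.

(* A wall which is not fixed by g has infinitely many translates under the
   powers of g, while only finitely many walls separate x from y. *)
Lemma pow_not_sep g W x y : isw W -> act g W <> W ->
  exists j, pos (act (g ^+ j) W) x = pos (act (g ^+ j) W) y.
Proof.
move=> iW gW; apply: contrapT => h.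
pose l := [seq act (g ^+ j) W | j <- iota 0 (size (sep x y)).+1].
have ul : uniq l.
  rewrite map_inj_in_uniq ?iota_uniq // => i j _ _.
  wlog ij : i j / (i <= j)%N.
    by move=> w e; case: (leqP i j) => [/w->|/ltnW/w->].
  move=> e; apply/eqP; rewrite eqn_leq ij /= leqNgt; apply/negP => lt.
  apply: gW; apply: (@pow_fix _ (j - i)) => //; first by rewrite subn_gt0.
  apply: (@act_inj _ (g ^+ i)); rewrite -actM -expgnDr subnKC //.
suff /(uniq_leq_size ul) : {subset l <= sep x y} by rewrite size_map size_iota ltnn.
move=> V /mapP[j _ ->]; rewrite mem_sep; apply/eqP => e.
by apply: h; exists j.
Qed.

(** For x in the side H, the powers of h keep x in H and g x in g H, which is disjoint from H. So
    every translate of W under the powers of h^-1 separates x from g x, and only finitely many walls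
    do. *)
Lemma disj_fix g h W b : isw W -> disj g W b -> commute g h ->
  (forall x, pos W x = b -> pos W (h * x) = b) -> act h W = W.
Proof.
move=> iW dg c hb; have hj j x : pos W x = b -> pos W (h ^+ j * x) = b.
  by elim: j => [|j IH] xb; rewrite ?mul1g // expgS -mulgA; apply/hb/IH.
suff e : act h^-1 W = W by rewrite -{1}e actVK.
apply: contrapT => ne; have [x xb] := isw_side b iW.
have [j] := pow_not_sep x (g * x) iW ne.
rewrite expVgn !posV hj // mulgA -(commuteX j c) -mulgA dg ?hj //.
by case: (b).
Qed.

(** W and its translate by g^k are nested in one of four ways. In the three unwanted ones g^k,
    g^(k+1) or g^-k maps the side into itself, hence fixes W, and then so does g, which is
    absurd. *)
Lemma disjX g W b k : isw W -> disj g W b -> (0 < k)%N -> disj (g ^+ k) W b.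
Proof.
move=> iW dg k0.
have nfix h : commute g h -> act h W = W ->
  (exists2 m, (0 < m)%N & h = g ^+ m \/ h = g ^- m) -> False.
  move=> c e [m m0 hm].
  have em : act (g ^+ m) W = W.
    by case: hm e => -> // e; rewrite -{1}e actVK.
  have gW := pow_fix iW m0 em.
  have [x xb] := isw_side b iW; have := dg x xb; rewrite -{1}gW posM xb.
  by case: (b).
have [b1 [c1 h]] := @same_type_nested (act (g ^+ k) W) W erefl.
have {}h x : pos W x = b1 -> pos W (g ^+ k * x) = c1 by rewrite -{1}(posM (g ^+ k));
  apply: h.
have cX m : commute g (g ^+ m) by apply: commuteX.
case: (b1 =P b) => [e1|n1]; case: (c1 =P b) => [e2|n2].
- exfalso; apply: (nfix (g ^+ k)) => //; last by exists k => //; left.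
  by apply: (disj_fix iW dg) => // x; rewrite -{1}e1 => /h ->.
- move=> x; rewrite -e1 => /h ->.
  by move: n2; rewrite -e1; case: (b1) (c1) e1 => -[].
- exfalso; apply: (nfix (g ^+ k.+1)) => //; last by exists k.+1 => //; left.
  apply: (disj_fix iW dg) => // x xb; rewrite expgSr -mulgA h //.
  by rewrite dg //; case: (b) (b1) n1 => -[].
- have nb : ~~ b = b1 /\ ~~ b = c1 by case: (b) (b1) (c1) n1 n2 => -[] [].
  exfalso; apply: (nfix (g ^- k)); [exact: commuteV| |by exists k => //; right].
  apply: (disj_fix iW dg); first exact: commuteV.
  move=> x xb; case: (boolP (pos W (g ^- k * x) == b1)) => [/eqP/h|].
    by rewrite mulVKg xb; case: nb => _ <-; case: (b).
  by case: nb => <- _; case: (pos W _) (b) => -[].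
Qed.

Lemma disj_nonper g W b : isw W -> disj g W b -> nonper g W -> False.
Proof.
move=> iW dg; have [x xb] := isw_side b iW.
have nb c : sub g W c -> False.
  case: (c =P b) => [->|cb] hc; first by have := hc x xb; rewrite dg //; case: (b).
  have := hc (g^-1 * x); rewrite (disjV dg) // mulVKg xb.
  by case: (b) (c) cb => -[] // _ /(_ erefl).
by case=> /nb.
Qed.

(** * Convex sets and foldings *)

Lemma not_isw W x y : ~ isw W -> pos W x = pos W y.
Proof. by move=> h; apply/eqP; rewrite -[_ == _]negbK; apply/negP => n; apply: h;
  exists x, y. Qed.

Lemma eq_pos_isw x y : (forall W, isw W -> pos W x = pos W y) -> x = y.
Proof.
by move=> h; apply: eq_pos => W; case: (pselect (isw W)) => [/h|/not_isw].
Qed.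

(** y is a nearest point: if a wall between x and y had z in I on its other side, the median of x,
    y, z would be a nearer point of I. *)
Lemma gate (I : set G) x : convex S I -> I !=set0 ->
  exists2 y, I y & forall z W, I z -> W \in sep x y -> pos W z = pos W y.
Proof.
move=> cI [z0 Iz0].
have ex : exists n, `[< exists2 y, I y & len S (x^-1 * y) = n >].
  by exists (len S (x^-1 * z0)); apply/asboolP; exists z0.
case: (ex_minnP ex) => n /asboolP[y Iy ny] nmin; exists y => // z W Iz Wxy.
apply/eqP; apply: contraT => zy.
have Im : I (Y S x y z).
  apply: (cI y z) => //; apply/intervalP => V.
  by rewrite YE; case: (pos V x) (pos V y) (pos V z) => -[] [].
have : (n <= len S (x^-1 * Y S x y z))%N by apply: nmin; apply/asboolP;
  exists (Y S x y z).
rewrite -ny -!size_sep leqNgt => /negP[].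
apply: (@uniq_leq_size _ (W :: sep x (Y S x y z))).
  rewrite /= uniq_sep andbT mem_sep YE; move: Wxy zy; rewrite mem_sep.
  by case: (pos W x) (pos W y) (pos W z) => -[] [].
move=> V; rewrite inE => /orP[/eqP->//|]; rewrite !mem_sep YE.
by case: (pos V x) (pos V y) (pos V z) => -[] [].
Qed.

Lemma phi_nonper w W x : nonper w W -> pos W (phi S w x) = pos W x.
Proof.
suff h b : sub w W b -> pos W (phi S w x) = pos W x by case=> /h.
move=> sb; rewrite /phi YE.
case: (boolP (pos W x == b)) => [/eqP xb|xb]; first by rewrite (sb _ xb) xb;
  case: (b) (pos W _) => -[].
have {}xb : pos W x = ~~ b by case: (pos W x) (b) xb => -[].
by rewrite (subV sb xb) xb; case: (b) (pos W (w * x)) => -[].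
Qed.

(** At most one of w x, x, w^-1 x lies in the side b: w moves that side off itself, and so does
    w^2. *)
Lemma phi_disj w W b x : isw W -> disj w W b -> pos W (phi S w x) = ~~ b.
Proof.
move=> iW db; rewrite /phi YE.
case: (boolP (pos W x == b)) => [/eqP xb|xb].
  by rewrite xb (db _ xb) (disjV db xb); case: (b).
have {}xb : pos W x = ~~ b by case: (pos W x) (b) xb => -[].
have := disjX iW db (isT : (0 < 2)%N) (x := w^-1 * x).
rewrite expg2 -mulgA mulVKg xb.
by case: (b) (pos W (w * x)) (pos W (w^-1 * x)) => -[] [] // /(_ erefl).
Qed.

Lemma XP w x : X S w x <-> forall W b, isw W -> disj w W b -> pos W x = ~~ b.
Proof.
split=> [[y _ <-] W b iW db|h]; first exact: phi_disj.
exists x => //; apply: eq_pos_isw => W iW.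
case: (nonper_disj w W) => [|[b db]]; first exact: phi_nonper.
by rewrite (phi_disj _ iW db) (h W b iW db).
Qed.

Lemma phi_id w x : X S w x -> phi S w x = x.
Proof.
move=> /XP h; apply: eq_pos_isw => W iW.
case: (nonper_disj w W) => [|[b db]]; first exact: phi_nonper.
by rewrite (phi_disj _ iW db) (h W b iW db).
Qed.

Lemma X_phi w x : X S w (phi S w x). Proof. by exists x. Qed.

Lemma X_reduced w x : X S w x <->
  forall W, pos W (w * x) != pos W x -> pos W (w^-1 * x) != pos W x -> False.
Proof.
split=> [/phi_id e W|h].
  have : pos W (phi S w x) = pos W x by rewrite e.
  by rewrite /phi YE; case: (pos W x) (pos W (w * x)) (pos W (w^-1 * x)) => -[] [].
exists x => //; apply: eq_pos => W; rewrite /phi YE; have := h W.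
by case: (pos W x) (pos W (w * x)) (pos W (w^-1 * x)) => -[] [] //= /(_ isT isT).
Qed.

Lemma X1 (v : G) : X S v 1 <-> forall W, W \in Nw v -> W \in Nw v^-1 -> False.
Proof.
by rewrite X_reduced; split=> h W; have := h W; rewrite !Nw_pos !mulg1.
Qed.

Lemma XJ w a x : X S (w ^ a) x <-> X S w (a * x).
Proof.
rewrite !X_reduced; split=> h W.
  by have := h (act a^-1 W); rewrite !posV -conjVg !conjgE -!mulgA !mulVKg.
by have := h (act a W); rewrite !pos_act -conjVg !conjgE !mulgA mulVg mul1g -!mulgA.
Qed.

Lemma XJ1 w a : X S w a <-> X S (w ^ a) 1.
Proof. by rewrite XJ mulg1. Qed.

Lemma XV w : X S w^-1 = X S w.
Proof.
by apply/seteqP; split=> x; rewrite !X_reduced => h W; have := h W;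
  rewrite invgK => + a b; apply.
Qed.

Lemma sub_act g h W b : commute g h -> sub g W b -> sub g (act h W) b.
Proof.
move=> c hb x; rewrite !pos_act => /hb.
by rewrite !mulgA (commuteV c).
Qed.

Lemma disj_act g h W b : commute g h -> disj g W b -> disj g (act h W) b.
Proof.
move=> c hb x; rewrite !pos_act => /hb.
by rewrite !mulgA (commuteV c).
Qed.

Lemma nonper_act g h W : commute g h -> nonper g W -> nonper g (act h W).
Proof. by move=> c [] /(sub_act c); [left|right]. Qed.

(* The walls crossed by the axes of w. *)
Definition ax w W : Prop := [/\ isw W, nonper w W & act w W <> W].

Lemma ax_act g h W : commute g h -> ax g W -> ax g (act h W).
Proof.
move=> c [iW nW gW]; split; [exact: isw_act|exact: nonper_act|].
by rewrite -actM c actM => /act_inj.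
Qed.

Lemma nonperV g W : nonper g W -> nonper g^-1 W.
Proof. by case=> /subV /nonperI. Qed.

Lemma axV g W : ax g W -> ax g^-1 W.
Proof.
case=> iW nW gW; split=> //; first exact: nonperV.
by move=> e; apply: gW; rewrite -{1}e actVK.
Qed.

Lemma X_act w z x : commute w z -> X S w x -> X S w (z * x).
Proof.
move=> c /XP h; apply/XP => W b iW db; rewrite -posV; apply: h; first exact: isw_act.
by apply: disj_act => //; apply: commuteV.
Qed.

Lemma X_nonper w W x y : X S w x -> X S w y -> pos W x != pos W y -> nonper w W.
Proof.
move=> /XP hx /XP hy xy; have iW : isw W by exists x, y.
case: (nonper_disj w W) => // -[b db].
by move: xy; rewrite (hx W b) // (hy W b) // eqxx.
Qed.

Lemma nonper_X w W b : isw W -> nonper w W -> exists2 x, X S w x & pos W x = b.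
Proof.
move=> iW nW; have [x <-] := isw_side b iW.
by exists (phi S w x); [apply: X_phi|apply: phi_nonper].
Qed.

(** Otherwise infinitely many translates of W would separate p from a point of the side b. *)
Lemma ax_end w W b p : ax w W -> sub w W b -> exists n, pos W (w ^+ n * p) = b.
Proof.
move=> aW sb; have [iW _ _] := aW; have [_ _ gW] := axV aW.
have [y yb] := isw_side b iW; have [j] := pow_not_sep p y iW gW.
by rewrite expVgn !posV (subX j sb yb) => e; exists j.
Qed.

Lemma ax_ends w W b p : ax w W -> exists2 z, zpowers w z & pos W (z * p) = b.
Proof.
move=> aW; have [_ nW _] := aW; wlog sb : w aW nW / sub w W b.
  move=> h; have [sb|] : sub w W b \/ sub w W (~~ b).
    by case: nW; case: (b); [left|right|right|left].
  - exact: (h w).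
  - move/subV; rewrite negbK => sb; have [z zw zb] := h _ (axV aW) (nonperV nW) sb.
    exists z => //; case: zw => n [] ->; exists n; rewrite expVgn ?invgK;
      [by right|by left].
by have [n] := ax_end p aW sb; exists (w ^+ n) => //; exists n; left.
Qed.

Lemma zpowers_commute w z : zpowers w z -> commute w z.
Proof. by case=> n [] ->; [apply: commuteX|apply: commuteV; apply: commuteX]. Qed.

Lemma X_ax w W x y : X S w x -> X S w y -> W \in sep x y ->
  ax w W \/ isw W /\ act w W = W.
Proof.
move=> Xx Xy; rewrite mem_sep => h; have iW : isw W by exists x, y.
case: (pselect (act w W = W)) => [|n]; first by right.
by left; split=> //; apply: X_nonper h.
Qed.

(** The right-hand side is convex in x and holds on the orbit of a. Conversely, a wall between x and
    its nearest point in a convex set containing the orbit does not cut the orbit, whereas an axial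
    wall does. *)
Lemma XaP w a x : X S w a -> Xa S w a x <-> forall W, W \in sep a x -> ax w W.
Proof.
move=> Xwa; split=> [h|h I [cI sI]].
  suff : [set x | forall W, W \in sep a x -> ax w W] x by [].
  apply: h; split=> [y z hy hz t /intervalP ht W|_ [z zw <-] W].
    rewrite mem_sep => hW; case: (boolP (pos W y == pos W a)) => [/eqP ya|ya].
      case: (boolP (pos W z == pos W a)) => [/eqP za|za].
        by move: hW; rewrite ht ?ya ?za // eqxx.
      by apply: hz; rewrite mem_sep eq_sym.
    by apply: hy; rewrite mem_sep eq_sym.
  have cz := zpowers_commute zw.
  move=> hW; case: (X_ax Xwa (X_act cz Xwa) hW) => // -[iW fW]; exfalso; move: hW.
  suff fz : act z W = W by rewrite mem_sep -{2}fz posM eqxx.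
  have fX n : act (w ^+ n) W = W.
    by elim: n => [|n IH]; rewrite ?act1 // expgS actM IH.
  by case: zw => n [] -> //; rewrite -{1}(fX n) actK.
have Ia z : zpowers w z -> I (z * a) by move=> zw; apply: sI; exists z.
have z1 : zpowers w 1 by exists 0%N; left.
have I0 : I !=set0 by exists (1 * a); apply: Ia.
have [y Iy hy] := gate x cI I0; suff -> : x = y by [].
apply: eq_pos => W; apply/eqP; apply: contraT; rewrite -mem_sep => Wxy.
have aW : ax w W.
  apply: h; have := hy _ _ (Ia _ z1) Wxy; rewrite mul1g mem_sep => ->.
  by move: Wxy; rewrite mem_sep eq_sym.
have [z zw] := ax_ends (~~ pos W y) a aW; rewrite (hy _ _ (Ia _ zw) Wxy).
by case: (pos W y).
Qed.

Lemma Xa_convex w a : convex S (Xa S w a).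
Proof.
move=> x y hx hy z hz I [cI sI]; apply: (cI x y) => //; first exact: hx.
exact: hy.
Qed.

Lemma nonperX w k W : isw W -> (0 < k)%N -> nonper (w ^+ k) W <-> nonper w W.
Proof.
move=> iW k0; split=> [n|[] /(subX k) /nonperI //].
by case: (nonper_disj w W) => // -[b /(disjX iW)/(_ k0) /(disj_nonper iW)] /(_ n).
Qed.

Lemma actX_fix w k W : act w W = W -> act (w ^+ k) W = W.
Proof. by move=> h; elim: k => [|k IH]; rewrite ?act1 // expgS actM IH. Qed.

Lemma axX w k W : (0 < k)%N -> ax (w ^+ k) W <-> ax w W.
Proof.
move=> k0; split=> -[iW nW gW]; split=> //.
- exact/(nonperX _ iW k0).
- by move/(actX_fix k).
- exact/(nonperX _ iW k0).
- by move/(pow_fix iW k0).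
Qed.

Lemma disj_uniq g W b c : isw W -> disj g W b -> disj g W c -> b = c.
Proof.
move=> iW db dc; case: (c =P b) => [->//|cb];
  have {}cb : c = ~~ b by case: (c) (b) cb => -[].
have [y yb] := isw_side b iW; have := disjX iW db (isT : (0 < 2)%N) yb.
rewrite expg2 -mulgA dc ?db // cb negbK.
by case: (b).
Qed.

Lemma X_pow w k : (0 < k)%N -> X S (w ^+ k) = X S w.
Proof.
move=> k0; apply/seteqP; split=> x /XP h; apply/XP => W b iW db.
  by apply: h => //; apply: disjX.
case: (nonper_disj w W) => [/(nonperX _ iW k0) n|[c dc]].
  by case: (disj_nonper iW db n).
by rewrite (h W c) // (disj_uniq iW db (disjX iW dc k0)).
Qed.

Lemma phi_folding w : folding S (phi S w).
Proof.
move=> x y z; apply: eq_pos_isw => W iW; rewrite YE.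
case: (nonper_disj w W) => [n|[b db]]; first by rewrite !phi_nonper // YE.
by rewrite !(phi_disj _ iW db); case: (b) (pos W y) => -[].
Qed.

(** * Orthogonal products *)

Lemma zpowers_fix g z W : zpowers g z -> act g W = W -> act z W = W.
Proof.
by case=> n [] -> /(actX_fix n) // e; rewrite -{1}e actK.
Qed.

Lemma zpowers_gen (T : set G) g z : zpowers g z -> gen T g -> gen T z.
Proof. by case=> n [] -> /genX // h; apply: genV. Qed.

Lemma fix_pos g W x : act g W = W -> pos W (g * x) = pos W x.
Proof. by move=> e; rewrite -{1}e posM. Qed.

Lemma fix_sub g W b : act g W = W -> sub g W b.
Proof. by move=> e x; rewrite fix_pos. Qed.

Lemma fix_nonper g W : act g W = W -> nonper g W.
Proof. by move=> e; left; apply: fix_sub. Qed.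

(** The orbit of a point under the powers of g stays on its side of W and visits both sides of V, so
    that W and V are transverse. *)
Lemma fix_ax_adj g W V : isw W -> act g W = W -> ax g V -> adj S W.1 V.1.
Proof.
move=> iW gW aV; apply: transverse_adj => b c; have [x xb] := isw_side b iW.
have [z zg zc] := ax_ends c x aV; exists (z * x); split=> //.
by rewrite fix_pos // (zpowers_fix zg gW).
Qed.

Lemma ax_Nw (v : G) W : ax v W -> exists2 z, zpowers v z & W \in Nw z.
Proof.
move=> aW; have [z zv zb] := ax_ends (~~ pos W 1) 1 aW; exists z => //.
by rewrite Nw_pos -(mulg1 z) zb; case: (pos W 1).
Qed.

Lemma ax_supp (v : G) W : ax v W -> supp v W.1.
Proof. by case/ax_Nw => z zv; apply: (zpowers_gen zv); apply: gen_supp. Qed.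

Lemma Nw_ax (v : G) W : X S v 1 -> W \in Nw v -> ax v W.
Proof.
move=> X1v Wv; have Xv : X S v v by rewrite -{2}(mulg1 v); apply: X_act.
rewrite Nw_sep in Wv; case: (X_ax X1v Xv Wv) => // -[_ e]; move: Wv.
by rewrite mem_sep -{1}(mulg1 v) fix_pos // eqxx.
Qed.

(** A wall between two points of [X S v] is axial or fixed, and a fixed wall is transverse to every
    axial one. *)
Lemma X_supp (v : G) c s : X S v 1 -> X S v c -> supp c s ->
  supp v s \/ forall t, supp v t -> adj S s t.
Proof.
move=> X1v Xc [W Wc <-]; rewrite Nw_sep in Wc.
case: (X_ax X1v Xc Wc) => [/ax_supp|[iW fW]]; first by left.
by right=> t [V /(Nw_ax X1v) aV <-]; apply: fix_ax_adj aV.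
Qed.

Lemma supp_letter a s : S a.1 -> supp (letter_val a) s -> s = a.1.
Proof. by move=> Sa [W]; rewrite letter_walls // inE => /eqP-> <-; rewrite edge1. Qed.

Lemma gen_letter (T : set G) a : S a.1 -> T a.1 -> gen T (letter_val a).
Proof. by move=> Sa Ta; apply/genP => s /(supp_letter Sa) ->. Qed.

Lemma gen_conj (T : set G) x c : gen T x ->
  (forall s, supp c s -> T s \/ forall t, T t -> adj S s t) -> gen T (x ^ c).
Proof.
move=> + hc; have {}hc a : a \in gd c -> T a.1 \/ forall t, T t -> adj S a.1 t.
  by move=> /gd_supp /hc.
rewrite -(gd_val c); have := @gd_words c; elim: (gd c) x hc => [|a u IH] x hc.
  by move=> _; rewrite word_val_nil conjg1.
case/words_cons => Sa Su hx; rewrite word_val_cons conjgM; apply: IH => //.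
  by move=> b bu; apply: hc; rewrite inE bu orbT.
case: (hc a (mem_head _ _)) => h; last first.
  have /csupp_commute c1 : csupp (letter_val a) x.
    move=> s t /(supp_letter Sa) -> xt; apply: h.
    by move/genP: hx; apply.
  by rewrite conjgE -c1 mulKg.
by rewrite conjgE; have ha := gen_letter Sa h; apply: genM; [apply: genV|apply: genM].
Qed.

Lemma csupp_gen x y x' y' : csupp x y -> gen (supp x) x' -> gen (supp y) y' ->
  csupp x' y'.
Proof. by move=> h /genP hx /genP hy s t /hx xs /hy yt; apply: h. Qed.

Lemma csupp_ax_fix x y W : csupp x y -> ax y W -> act x W = W.
Proof.
move=> h /ax_Nw[z zy Wz]; apply: csupp_fix Wz.
by apply: csupp_gen h _ _; [apply: gen_supp|apply: zpowers_gen zy _; apply: gen_supp].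
Qed.

Lemma csuppM_X1 x y : csupp x y -> X S (x * y) 1 -> X S x 1.
Proof.
move=> h /X1 hX; apply/X1 => W Wx WV; apply: (hX W); first by rewrite csuppM_Nw // Wx.
have h' : csupp x^-1 y^-1 by move=> s t; rewrite !suppV; apply: h.
have -> : (x * y)^-1 = x^-1 * y^-1 by rewrite (csupp_commute h') invgM.
by rewrite csuppM_Nw // WV.
Qed.

Lemma csuppM_fix_sub x y W b : act x W = W -> sub (x * y) W b <-> sub y W b.
Proof.
move=> e; split=> h z zb; have := h z zb; first by rewrite -mulgA (fix_pos _ e).
by rewrite -mulgA (fix_pos _ e).
Qed.

Lemma csuppM_fix_nonper x y W : act x W = W -> nonper (x * y) W <-> nonper y W.
Proof.
by move=> e; split=> -[] /(csuppM_fix_sub _ _ e) /nonperI.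
Qed.

Lemma csuppM_fix_ax x y W : commute x y -> act x W = W -> ax (x * y) W <-> ax y W.
Proof.
move=> c e; have ee : act (x * y) W = act y W by rewrite c actM e.
by split=> -[iW nW gW]; split=> //; rewrite ?ee // -?ee //;
  apply/(csuppM_fix_nonper _ e).
Qed.

(** One factor always fixes W, because x fixes the axial walls of y and conversely; the product then
    acts on W like the other factor. *)
Lemma csuppM_nonper_aux x y W : csupp x y -> isw W -> nonper x W -> nonper y W ->
  nonper (x * y) W /\ (ax (x * y) W <-> ax x W \/ ax y W).
Proof.
move=> h iW nx ny; have c := csupp_commute h.
have nax g : act g W = W -> ~ ax g W by move=> e [].
case: (pselect (act x W = W)) => [fx|fx].
  split; first exact/csuppM_fix_nonper.
  rewrite csuppM_fix_ax //; split; first by right.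
  by case=> // /(nax _ fx).
case: (pselect (act y W = W)) => [fy|fy].
  rewrite c; split; first exact/csuppM_fix_nonper.
  rewrite csuppM_fix_ax //; split; first by left.
  by case=> // /(nax _ fy).
have ax_x : ax x W by [].
by case: fy; apply: csupp_ax_fix ax_x; apply: csupp_sym.
Qed.

(** Conjugation by a point c of [X S (x * y)] keeps each factor in the subgroup of its support, so
    the conjugated product is again one with commuting supports and its factors inherit
    reducedness. *)
Lemma csuppM_X x y c : csupp x y -> X S (x * y) 1 ->
  X S (x * y) c <-> X S x c /\ X S y c.
Proof.
move=> h X1v; have cxy := csupp_commute h.
have h' := csupp_sym h; have X1v' : X S (y * x) 1 by rewrite -cxy.
have X1x := csuppM_X1 h X1v; have X1y := csuppM_X1 h' X1v'.
split=> [Xc|[/XP Xx /XP Xy]].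
  have sc s : supp c s -> supp (x * y) s \/ forall t, supp (x * y) t -> adj S s t.
    exact: X_supp.
  rewrite suppM // in sc.
  have gx : gen (supp x) (x ^ c).
    apply: gen_conj (@gen_supp x) _ => s /sc [[]|hs]; [by left| |].
      by move=> ys; right=> t xt; apply: h'.
    by right=> t xt; apply: hs; left.
  have gy : gen (supp y) (y ^ c).
    apply: gen_conj (@gen_supp y) _ => s /sc [[]|hs]; [|by left|].
      by move=> ys; right=> t xt; apply: h.
    by right=> t xt; apply: hs; right.
  have hc := csupp_gen h gx gy.
  move/XJ1: Xc; rewrite conjMg => Xc; split; apply/XJ1; first exact: csuppM_X1 Xc.
  by apply: csuppM_X1 (csupp_sym hc) _; rewrite -(csupp_commute hc).
apply/XP => W b iW db.
(* The sides avoided for z and for the product agree, since 1 belongs to both sets. *)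
have key z : X S z 1 -> (forall W b, isw W -> disj z W b -> pos W c = ~~ b) ->
    forall b', disj z W b' -> pos W c = ~~ b.
  move=> /XP X1z Xzc b' db'; rewrite (Xzc W b' iW db').
  by rewrite -(X1z W b' iW db'); apply: (iffLR (XP _ _) X1v).
case: (nonper_disj x W) => [nx|[b']]; last exact: key.
case: (nonper_disj y W) => [ny|[b']]; last exact: key.
by have [/(disj_nonper iW db)] := csuppM_nonper_aux h iW nx ny.
Qed.

(** A nonperipheral wall of the product has points of [X S (x * y)] on both sides. They lie in the
    sets of both factors, so neither factor avoids a side. *)
Lemma csuppM_nonper x y W : csupp x y -> X S (x * y) 1 -> isw W ->
  nonper (x * y) W <-> nonper x W /\ nonper y W.
Proof.
move=> h X1v iW; split=> [n|[nx ny]]; last by have [] := csuppM_nonper_aux h iW nx ny.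
have [p Xp pb] := nonper_X true iW n; have [q Xq qb] := nonper_X false iW n.
have [Xpx Xpy] := iffLR (csuppM_X _ h X1v) Xp.
have [Xqx Xqy] := iffLR (csuppM_X _ h X1v) Xq.
by split; [apply: X_nonper Xpx Xqx _|apply: X_nonper Xpy Xqy _]; rewrite pb qb.
Qed.

Lemma csuppM_ax x y W : csupp x y -> X S (x * y) 1 ->
  ax (x * y) W <-> ax x W \/ ax y W.
Proof.
move=> h X1v; split=> [aW|aW].
  have [iW nW _] := aW; have [nx ny] := iffLR (csuppM_nonper h X1v iW) nW.
  by have [_ <-] := csuppM_nonper_aux h iW nx ny.
have [iW nx ny] : [/\ isw W, nonper x W & nonper y W].
  case: aW => aW; have [iW nW _] := aW; split=> //; apply: fix_nonper.
    by apply: csupp_ax_fix aW; apply: csupp_sym.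
  exact: csupp_ax_fix aW.
by have [_ ->] := csuppM_nonper_aux h iW nx ny.
Qed.

(** * Finite families with pairwise commuting supports *)

Definition orth_family (I : eqType) (r : seq I) (x : I -> G) : Prop :=
  uniq r /\ {in r &, forall i j, i <> j -> csupp (x i) (x j)}.

Lemma orth_family_cons (I : eqType) i (r : seq I) (x : I -> G) :
  orth_family (i :: r) x ->
  orth_family r x /\ forall j, j \in r -> csupp (x i) (x j).
Proof.
move=> [/= /andP[ir ur] h]; split=> [|j jr].
  by split=> // j k jr kr; apply: h; rewrite inE ?jr ?kr orbT.
by apply: h; rewrite ?inE ?eqxx ?jr ?orbT // => e; rewrite e jr in ir.
Qed.

Section Family.
Variables (I : eqType) (x : I -> G).
Implicit Types (r : seq I).

Lemma supp_prod r : supp (\prod_(i <- r) x i) `<=` [set s | exists2 i, i \in r & supp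
  (x i) s].
Proof.
elim: r => [|i r IH] s; first by rewrite big_nil => /supp1.
rewrite big_cons; move: s; apply/genP; apply: genM.
  by apply/genP => s hs; exists i => //; rewrite mem_head.
by apply/genP => s /IH[j jr hs]; exists j => //; rewrite inE jr orbT.
Qed.

Lemma orth_family_csupp i r : orth_family (i :: r) x ->
  csupp (x i) (\prod_(j <- r) x j).
Proof.
by move=> /orth_family_cons[_ h] s t xs /supp_prod[j jr xt]; apply: h jr _ _ xs xt.
Qed.

Lemma orth_prod_Nw r W : orth_family r x ->
  W \in Nw (\prod_(i <- r) x i) <-> exists2 i, i \in r & W \in Nw (x i).
Proof.
elim: r => [|i r IH] o; first by rewrite big_nil Nw1; split=> // -[].
have [o' _] := orth_family_cons o.
rewrite big_cons csuppM_Nw; last exact: orth_family_csupp.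
split=> [/orP[h|/(IH o')[j jr h]]|[j]].
- by exists i; rewrite ?mem_head.
- by exists j; rewrite ?inE ?jr ?orbT.
rewrite inE => /orP[/eqP->->//|jr h]; apply/orP; right; apply/(IH o').
by exists j.
Qed.

Lemma orth_prod_X r : orth_family r x -> X S (\prod_(i <- r) x i) 1 ->
  [/\ forall c, X S (\prod_(i <- r) x i) c <-> forall i, i \in r -> X S (x i) c,
      forall W, isw W -> nonper (\prod_(i <- r) x i) W <-> forall i, i \in r ->
        nonper (x i) W &
      forall W, ax (\prod_(i <- r) x i) W <-> exists2 i, i \in r & ax (x i) W].
Proof.
elim: r => [|i r IH] o.
  rewrite big_nil => _; split=> [c|W|W].
  - split=> // _; apply/XP => W b iW db; have [z zb] := isw_side b iW.
    by have := db z zb; rewrite mul1g zb; case: (b).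
  - by split=> // _; left=> z; rewrite mul1g.
  - by split=> [[_ _]|[]//]; rewrite act1.
have [o' _] := orth_family_cons o; have cs := orth_family_csupp o.
rewrite big_cons => X1p; have X1i := csuppM_X1 cs X1p.
have X1r : X S (\prod_(j <- r) x j) 1.
  by apply: csuppM_X1 (csupp_sym cs) _; rewrite -(csupp_commute cs).
have [h1 h2 h3] := IH o' X1r; split=> [c|W iW|W].
- rewrite csuppM_X // h1; split=> [[hi hr] j|h].
    by rewrite inE => /orP[/eqP->|/hr].
  by split=> [|j jr]; apply: h; rewrite inE ?eqxx ?jr ?orbT.
- rewrite csuppM_nonper // h2 //; split=> [[hi hr] j|h].
    by rewrite inE => /orP[/eqP->|/hr].
  by split=> [|j jr]; apply: h; rewrite inE ?eqxx ?jr ?orbT.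
- rewrite csuppM_ax // h3; split=> [[h|[j jr h]]|[j]].
  + by exists i; rewrite ?mem_head.
  + by exists j; rewrite ?inE ?jr ?orbT.
  by rewrite inE => /orP[/eqP->|jr h]; [left|right; exists j].
Qed.

End Family.

(** With a common upper bound z, the points 1, y, x, z are the corners of a square for any wall of x
    and any wall of y. Conversely x y is the least upper bound. *)
Lemma orthogonalP x y : orthogonal S x y <-> csupp x y.
Proof.
split=> [[m [z [/precP xz /precP yz _]]] s t [W Wx <-] [V Vy <-]|h].
  have d U : U \in Nw x -> U \in Nw y -> False.
    rewrite !Nw_pos => Ux Uy; have := meetE x y U; rewrite m.
    by case: (pos U x) (pos U y) (pos U 1) Ux Uy => -[] [].
  have Wy : W \notin Nw y by apply/negP; apply: d.
  have Vx : V \notin Nw x by apply/negP => /d; apply.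
  apply: transverse_adj; apply: (@transverseI _ _ 1 y x z).
  - by move: Wy; rewrite Nw_pos negbK eq_sym => /eqP.
  - by rewrite xz // -Nw_pos.
  - by move: Wx; rewrite Nw_pos eq_sym.
  - by move: Vx; rewrite Nw_pos negbK eq_sym => /eqP.
  - by rewrite yz // -Nw_pos.
  - by move: Vy; rewrite Nw_pos eq_sym.
split.
  apply: eq_pos => W; rewrite meetE.
  have : W \in Nw x -> W \in Nw y -> False by apply: csupp_Nw_disjoint.
  by rewrite !Nw_pos; case: (pos W x) (pos W y) (pos W 1) => -[] [] //= /(_ isT isT).
have hN W : (pos W (x * y) != pos W 1) = (pos W x != pos W 1) || (pos W y != pos W 1).
  by rewrite -!Nw_pos csuppM_Nw.
exists (x * y); split=> [||t /precP xt /precP yt]; apply/precP => W.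
- by have := hN W; case: (pos W x) (pos W y) (pos W 1) (pos W (x * y)) => -[] [] [].
- by have := hN W; case: (pos W x) (pos W y) (pos W 1) (pos W (x * y)) => -[] [] [].
rewrite hN => h2; have := hN W; have := xt W; have := yt W; move: h2.
by case: (pos W x) (pos W y) (pos W 1) (pos W (x * y)) (pos W t) =>
  -[] [] [] [] //= _ h3 h4 _;
  solve [exact: (h3 isT) | exact: (h4 isT)].
Qed.

(** * The groups H_v *)

Lemma pos_inj W V : isw W -> (forall x, pos W x = pos V x) -> V = W.
Proof.
case/isw_edge=> g [a [Sa ->]] h; apply/eqP; rewrite -letter_sep // -!h.
by rewrite letter_sep.
Qed.

Lemma crs_sgn W x : W \in Nw x -> crs W x = sgn (pos W x).
Proof.
rewrite mem_Nw => n0; have := crs_bound x W.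
case: (Order.TotalTheory.ltgtP (crs W x) (crs W 1)) => [h|h|].
- by have [_ /negbTE->] := pos_crs h; move: h; rewrite crs1 /sgn; lia.
- by have [-> _] := pos_crs h; move: h; rewrite crs1 /sgn; lia.
by move=> e; rewrite e crs1 eqxx in n0.
Qed.

(* The walls of type t in the axis of v, oriented by the action of v. *)
Definition axis_weight (v : G) t W : int :=
  if `[< ax v W /\ W.1 = t >] then sgn `[< sub v W true >] else 0%R.

Definition tau (v : G) (t x : G) : int := coc (axis_weight v t) x.

Lemma axis_weight_act (v : G) t g : commute v g ->
  axis_weight v t \o act g = axis_weight v t.
Proof.
move=> c; apply/funext => W /=; rewrite /axis_weight.
have cV : commute v g^-1 by apply: commuteV.
have -> : `[< ax v (act g W) /\ (act g W).1 = t >] = `[< ax v W /\ W.1 = t >].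
  apply/asboolP/asboolP => -[aW tW]; split=> //; last exact: ax_act.
  by rewrite -(actK g W); apply: ax_act.
have -> // : `[< sub v (act g W) true >] = `[< sub v W true >].
apply/asboolP/asboolP => h; last exact: sub_act.
by rewrite -(actK g W); apply: sub_act.
Qed.

Lemma tauM (v : G) t x y : commute v x -> tau v t (x * y) = (tau v t x + tau v t y)%R.
Proof. by move=> c; rewrite /tau cocM axis_weight_act. Qed.

Lemma tau1 (v : G) t : tau v t 1 = 0%R.
Proof. exact: coc1. Qed.

Lemma tauV (v : G) t x : commute v x -> tau v t x^-1 = (- tau v t x)%R.
Proof.
by move=> c; have := tauM t x^-1 c; rewrite mulgV tau1; lia.
Qed.

Lemma sub_asbool (v : G) W : ax v W -> sub v W `[< sub v W true >].
Proof. by case=> _ [] h _; [rewrite asboolT|case: asboolP]. Qed.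

Lemma ax_same_end (v : G) W V b c : ax v W -> ax v V -> sub v W b -> sub v V c ->
  exists p, pos W p = b /\ pos V p = c.
Proof.
move=> aW aV sW sV; have [n hn] := ax_end 1 aW sW; have [m hm] := ax_end 1 aV sV.
exists (v ^+ (m + n) * 1); split; rewrite expgnDr -mulgA.
  exact: (subX m sW hn).
by rewrite mulgA -expgnDr addnC expgnDr -mulgA; apply: (subX n sV hm).
Qed.

(* Two points separated in opposite directions by two axial walls of the same
   type would make these walls transverse. *)
Lemma ax_coherent (v : G) W V b c x y : ax v W -> ax v V -> W.1 = V.1 ->
  sub v W b -> sub v V c -> pos W x != pos W y -> pos V x != pos V y ->
  (pos W y == b) = (pos V y == c).
Proof.
move=> aW aV e sW sV Wxy Vxy.
case: ((pos W y == b) =P (pos V y == c)) => // /eqP ne; exfalso;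
  apply: (@adj_irr W.1); rewrite {2}e; apply: transverse_adj.
have [p [Wp Vp]] := ax_same_end aW aV sW sV.
have [q [Wq Vq]] := ax_same_end (axV aW) (axV aV) (subV sW) (subV sV).
move=> b' c'; have : exists z, [/\ pos W z = b' & pos V z = c']; last first.
  by case=> z [? ?]; exists z.
case: (b' =P b) => [->|nb]; case: (c' =P c) => [->|nc].
- by exists p.
- have {nc} -> : c' = ~~ c by case: (c) (c') nc => -[].
  case: (pos W y =P b) => Wy.
    by exists y; split=> //; move: ne; rewrite Wy eqxx /=; case: (pos V y) (c) => -[].
  exists x; move: ne Wxy Vxy Wy.
  by case: (pos W x) (pos W y) (pos V x) (pos V y) (b) (c) => -[] [] [] [] [].
- have {nb} -> : b' = ~~ b by case: (b) (b') nb => -[].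
  case: (pos V y =P c) => Vy.
    by exists y; split=> //; move: ne; rewrite Vy eqxx /=; case: (pos W y) (b) => -[].
  exists x; move: ne Wxy Vxy Vy.
  by case: (pos W x) (pos W y) (pos V x) (pos V y) (b) (c) => -[] [] [] [] [].
- have {nb} -> : b' = ~~ b by case: (b) (b') nb => -[].
  have {nc} -> : c' = ~~ c by case: (c) (c') nc => -[].
  by exists q.
Qed.

(** All axial walls of type t between x and y contribute to the difference of the two values with
    one and the same sign, so nothing cancels. *)
Lemma tau_sep (v : G) t x y W : tau v t x = tau v t y -> W \in sep x y ->
  ax v W -> W.1 = t -> False.
Proof.
move=> e Wxy aW Wt.
have {e} e : (\sum_(V <- Nw (x^-1 * y)) sgn (pos (act x V) y) * axis_weight v t (act
  x V) = 0)%R.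
  have : (tau v t y - tau v t x = coc (axis_weight v t \o act x) (x^-1 * y))%R.
    have := cocM (axis_weight v t) x (x^-1 * y); rewrite mulVKg /tau => ->.
    by rewrite addrAC subrr add0r.
  rewrite e subrr coc_Nw => /esym; rewrite big_seq [in X in _ -> X]big_seq => e'.
  rewrite -[RHS]e'; apply: eq_bigr => V /crs_sgn ->.
  by rewrite /= pos_act.
pose e0 := sgn (pos W y == `[< sub v W true >]).
have term V : V \in sep x y -> (sgn (pos V y) * axis_weight v t V =
    if `[< ax v V /\ V.1 = t >] then e0 else 0)%R.
  rewrite /axis_weight => Vxy; case: asboolP => [[aV Vt]|_]; last by rewrite mulr0.
  rewrite /e0 (@ax_coherent v W V _ `[< sub v V true >] x y) //.
  - by case: (pos V y) `[< _ >] => -[].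
  - by rewrite Wt.
  - exact: sub_asbool.
  - exact: sub_asbool.
  - by rewrite -mem_sep.
  - by rewrite -mem_sep.
have xW : act x^-1 W \in Nw (x^-1 * y) by rewrite -sepM mulVKg.
rewrite (perm_big _ (perm_to_rem xW)) big_cons actVK term // asboolT //= in e.
have : (e0 * (\sum_(V <- rem (act x^-1 W) (Nw (x^-1 * y)))
    sgn (pos (act x V) y) * axis_weight v t (act x V)) >= 0)%R.
  rewrite mulr_sumr big_seq; apply: Num.Theory.sumr_ge0 => V /mem_rem Vxy.
  rewrite term; last by rewrite mem_map //; apply: act_inj.
  by rewrite /e0; case: ifP => // _; case: (_ == _).
set sum := (\sum_(V <- rem _ _) _)%R in e *; clearbody sum.
by move: e; rewrite /e0; case: (_ == _); rewrite /sgn; lia.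
Qed.

Lemma HP (v : G) z : X S v 1 ->
  H S v z <-> commute v z /\ forall W, W \in Nw z -> ax v W.
Proof.
move=> X1v; rewrite /H; split=> [[c /(XaP _ X1v) h]|[c h]].
  by split=> [|W]; [rewrite /commute -c|rewrite Nw_sep; apply: h].
split; first by rewrite /centralizer /= c.
by apply/(XaP _ X1v) => W; rewrite -Nw_sep; apply: h.
Qed.

Section Hgroup.
Variable v : G.
Hypothesis X1v : X S v 1.

Lemma H_M x y : H S v x -> H S v y -> H S v (x * y).
Proof.
move=> /(HP _ X1v)[cx hx] /(HP _ X1v)[cy hy]; apply/(HP _ X1v).
split=> [|W Wxy]; first exact: commuteM.
case: (boolP (W \in Nw x)) => [/hx //|]; rewrite Nw_pos negbK => /eqP e.
rewrite -(actVK x W); apply: ax_act => //; apply: hy.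
by rewrite -sepM mem_sep e eq_sym -Nw_pos.
Qed.

Lemma H_V x : H S v x -> H S v x^-1.
Proof.
move=> /(HP _ X1v)[cx hx]; apply/(HP _ X1v).
split=> [|W Wx]; first exact: commuteV.
rewrite -(actK x W); apply: ax_act; first exact: commuteV.
by apply: hx; move: Wx; rewrite !Nw_pos !pos_act mulg1 mulVg eq_sym.
Qed.

Lemma H_id : H S v v.
Proof. by apply/(HP _ X1v); split=> // W; apply: Nw_ax. Qed.

Lemma H_1 : H S v 1.
Proof. by rewrite -(mulVg v); apply: H_M H_id; apply/H_V/H_id. Qed.

Lemma zpowers_H z : zpowers v z -> H S v z.
Proof.
have hX n : H S v (v ^+ n).
  by elim: n => [|n IH]; [apply: H_1|rewrite expgS; apply: H_M IH; apply: H_id].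
by case=> n [] ->; [|apply: H_V].
Qed.

Lemma H_gen z : H S v z -> gen (supp v) z.
Proof. by move=> /(HP _ X1v)[_ h] W /h /ax_supp. Qed.

Lemma H_eq1 z : H S v z -> (forall t, supp v t -> tau v t z = 0%R) -> z = 1.
Proof.
move=> /(HP _ X1v)[_ hz] h; apply: eq_pos => W; apply/eqP; apply: contraT.
rewrite -Nw_pos => Wz; exfalso.
apply: (@tau_sep v W.1 1 z W) => //; last exact: hz.
  by rewrite tau1 h //; apply/ax_supp/hz.
by rewrite -Nw_sep.
Qed.

Lemma H_commute x y : H S v x -> H S v y -> commute x y.
Proof.
move=> Hx Hy; apply/commgP/eqP; apply: H_eq1 => [|t _].
  by rewrite /commg conjgE; do !apply: H_M => //; apply: H_V.
have [[cx _] [cy _]] := (iffLR (HP _ X1v) Hx, iffLR (HP _ X1v) Hy).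
have cV z : commute v z -> commute v z^-1 by apply: commuteV.
rewrite /commg conjgE !tauM ?tauV //; try exact: cV.
by lia.
Qed.

End Hgroup.

Lemma axJ w a W : ax (w ^ a) W <-> ax w (act a W).
Proof.
have hs b : sub (w ^ a) W b <-> sub w (act a W) b.
  split=> h x; first by rewrite !pos_act => /h; rewrite conjgE -!mulgA mulVKg.
  by have := h (a * x); rewrite !pos_act !mulKg conjgE -!mulgA.
split=> -[iW nW gW]; split.
- exact: isw_act.
- by case: nW => /hs /nonperI.
- by move=> e; apply: gW; rewrite conjgE !actM e actK.
- by rewrite -(actK a W); apply: isw_act.
- by case: nW => /hs /nonperI.
- by move=> e; apply: gW; rewrite -{2}e conjgE !actM actVK.
Qed.

Lemma nonperJ w a W : nonper (w ^ a) W <-> nonper w (act a W).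
Proof.
have hs b : sub (w ^ a) W b <-> sub w (act a W) b.
  split=> h x; first by rewrite !pos_act => /h; rewrite conjgE -!mulgA mulVKg.
  by have := h (a * x); rewrite !pos_act !mulKg conjgE -!mulgA.
by split=> -[] /hs /nonperI.
Qed.

(** The walls between c and z c are axial for v or fixed by v. Their types lie in the support of v,
    and a fixed wall would be adjacent to an axial one of its own type. This makes primitivity
    independent of the chosen point. *)
Lemma H_conj (v : G) c z : X S v 1 -> X S v c -> H S v z -> H S (v ^ c) (z ^ c).
Proof.
move=> X1v Xc Hz; have [cz _] := iffLR (HP _ X1v) Hz.
have X1c : X S (v ^ c) 1 by exact: (iffLR (XJ1 v c) Xc).
apply/(HP _ X1c); split; first by rewrite /commute -!conjMg cz.
move=> W Wz; have t : supp v W.1.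
  apply: (gen_conj (H_gen X1v Hz)) Wz => s; exact: X_supp.
apply/axJ; have hs : act c W \in sep c (z * c).
  by rewrite (conjgC z c) sepM actK.
case: (X_ax Xc (X_act cz Xc) hs) => // -[iW fW].
case: t => V /(Nw_ax X1v) aV e; case: (@adj_irr W.1).
by rewrite -{2}e; apply: (fix_ax_adj iW fW aV).
Qed.

Lemma zpowersJ w z a : zpowers w z -> zpowers (w ^ a) (z ^ a).
Proof. by case=> n [] ->; exists n; rewrite ?conjVg conjXg; [left|right]. Qed.

Lemma H_zpowers_conj (v : G) c : X S v 1 -> X S v c -> H S v = zpowers v ->
  H S (v ^ c) = zpowers (v ^ c).
Proof.
move=> X1v Xc e; have X1c : X S (v ^ c) 1 by exact: (iffLR (XJ1 v c) Xc).
apply/seteqP; split=> z; last exact: zpowers_H.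
move=> Hz; have := @H_conj _ c^-1 z X1c.
rewrite XJ mulgV conjgK => /(_ X1v Hz); rewrite e => /(zpowersJ c).
by rewrite conjgKV.
Qed.

Lemma primitiveP w a : primitive S w -> X S w a -> H S (w ^ a) = zpowers (w ^ a).
Proof.
case=> _ [b Xb e] Xa; have -> : w ^ a = (w ^ b) ^ (b^-1 * a).
  by rewrite -conjgM mulVKg.
by apply: H_zpowers_conj e; [exact: (iffLR (XJ1 w b) Xb)|apply: (iffRL (XJ w b _));
  rewrite mulVKg].
Qed.

(** * Primitive decompositions *)

Lemma gen_split (T T' : set G) z : (forall s t, T s -> T' t -> adj S s t) ->
  gen (T `|` T') z -> exists x y, [/\ z = x * y, gen T x & gen T' y].
Proof.
move=> h /gen_word[u [Su Tu <-]] {z}; elim: u Su Tu => [|a u IH].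
  by exists 1, 1; rewrite mulg1 word_val_nil; split=> //; apply: gen1.
move=> /words_cons[Sa Su] Tu; have [|x [y [e hx hy]]] := IH Su.
  by move=> b bu; apply: Tu; rewrite inE bu orbT.
rewrite word_val_cons e; case: (Tu a (mem_head _ _)) => ha.
  exists (letter_val a * x), y; rewrite mulgA; split=> //.
  by apply: genM => //; apply: gen_letter.
exists x, (letter_val a * y); split=> //; last by apply: genM => //;
  apply: gen_letter.
have c : commute x (letter_val a).
  apply: csupp_commute => s t xs /(supp_letter Sa) ->; apply: h => //.
  by move/genP: hx; apply.
by rewrite !mulgA c.
Qed.

Lemma supp_zpowers (v z : G) s : zpowers v z -> supp z s -> supp z = supp v.
Proof.
case=> n [] ->; rewrite ?suppV; case: n => [|n] zs; try by case: (@supp1 s).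
  exact: supp_pow.
exact: supp_pow.
Qed.

Lemma H_split (v : G) x y : X S v 1 -> v = x * y -> csupp x y -> H S v x.
Proof.
move=> X1v e h; apply/(HP _ X1v); split=> [|W Wx].
  by rewrite e; apply: commute_sym; apply: commuteM; [|apply: csupp_commute].
by apply: Nw_ax => //; rewrite e csuppM_Nw // Wx.
Qed.

(** The primitive decomposition of a cyclically reduced element, seen from the base point 1. The
    index type is free: lists of pairs serve for existence, ordinals for the given definition. *)
Definition primitive_family (I : eqType) (r : seq I) (p : I -> G) (m : I ->
  nat) (v : G) : Prop :=
  [/\ X S v 1, v = \prod_(i <- r) p i ^+ m i,
      orth_family r (fun i => p i ^+ m i) &
      forall i, i \in r -> [/\ (0 < m i)%N, p i <> 1 & H S (p i) = zpowers (p i)]].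

Section PrimitiveFamily.
Variables (I : eqType) (r : seq I) (p : I -> G) (m : I -> nat) (v : G).
Hypothesis pf : primitive_family r p m v.

Let X1v : X S v 1. Proof. by case: pf. Qed.
Let ev : v = \prod_(i <- r) p i ^+ m i. Proof. by case: pf. Qed.
Let orth : orth_family r (fun i => p i ^+ m i). Proof. by case: pf. Qed.

Lemma family_gt0 i : i \in r -> (0 < m i)%N.
Proof. by case: pf => _ _ _ h /h[]. Qed.

Lemma family_csupp i j : i \in r -> j \in r -> i <> j -> csupp (p i) (p j).
Proof.
move=> ir jr ij s t; rewrite -(supp_pow (p i) (family_gt0 ir)).
rewrite -(supp_pow (p j) (family_gt0 jr)).
by case: orth => _ h; apply: h.
Qed.

Lemma family_X c : X S v c <-> forall i, i \in r -> X S (p i) c.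
Proof.
have [|h _ _] := orth_prod_X orth; first by rewrite -ev.
rewrite ev h; split=> hc i ir; have := hc i ir; rewrite X_pow //; exact: family_gt0.
Qed.

Lemma family_nonper W : isw W -> nonper v W <-> forall i, i \in r -> nonper (p i) W.
Proof.
move=> iW; have [|_ h _] := orth_prod_X orth; first by rewrite -ev.
rewrite ev h //; split=> hc i ir; have := hc i ir; rewrite nonperX //;
  exact: family_gt0.
Qed.

Lemma family_ax W : ax v W <-> exists2 i, i \in r & ax (p i) W.
Proof.
have [|_ _ h] := orth_prod_X orth; first by rewrite -ev.
rewrite ev h; split=> -[i ir hi]; exists i => //; move: hi; rewrite axX //;
  exact: family_gt0.
Qed.

Lemma family_X1 i : i \in r -> X S (p i) 1.
Proof. by move=> ir; apply: (iffLR (family_X 1)). Qed.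

Lemma family_Nw i : i \in r -> {subset Nw (p i) <= Nw v}.
Proof.
move=> ir W Wp; rewrite ev; apply/(orth_prod_Nw _ orth); exists i => //.
by apply: reduced_powP => //; [apply/X1/family_X1|apply: family_gt0].
Qed.

Lemma family_H i : i \in r -> H S v (p i).
Proof.
move=> ir; apply/(HP _ X1v); split=> [|W Wp]; last by apply: Nw_ax => //;
  apply: family_Nw Wp.
apply: commute_sym; rewrite ev big_seq; apply: commute_prod => j jr.
case: (i =P j) => [->|ij]; first exact: commuteX.
by apply: commuteX; apply: csupp_commute; apply: family_csupp.
Qed.

Lemma family_supp s : supp v s -> exists2 i, i \in r & supp (p i) s.
Proof.
case=> W; rewrite ev => /(orth_prod_Nw _ orth)[i ir Wi] <-; exists i => //.
by apply: (@suppX _ (m i)); exists W.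
Qed.

Lemma family_ax_supp i W : i \in r -> ax v W -> supp (p i) W.1 -> ax (p i) W.
Proof.
move=> ir /family_ax[j jr aj] s; case: (i =P j) => [->//|ij].
by case: (@adj_irr W.1); apply: (family_csupp ir jr ij) => //; apply: ax_supp.
Qed.

Lemma family_primitive i : i \in r -> H S (p i) = zpowers (p i).
Proof. by case: pf => _ _ _ h /h[]. Qed.

Lemma family_neq1 i : i \in r -> p i <> 1.
Proof. by case: pf => _ _ _ h /h[]. Qed.

Lemma family_inj i j : i \in r -> j \in r -> p i = p j -> i = j.
Proof.
move=> ir jr e; case: (i =P j) => // ij; have [s ps] := supp_neq1 (family_neq1 ir).
by case: (@adj_irr s); apply: (family_csupp ir jr ij) => //; rewrite -e.
Qed.

(* A primitive element cannot split along two commuting parts of its support. *)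
Lemma family_absorb i (q : G) s : i \in r -> X S q 1 -> H S q = zpowers q ->
  supp q `<=` supp v -> supp q s -> supp (p i) s -> supp q `<=` supp (p i).
Proof.
move=> ir X1q Hq qv qs ps.
pose T' := [set t | exists2 j, j \in r & j <> i /\ supp (p j) t].
have TT t t' : supp (p i) t -> T' t' -> adj S t t'.
  by move=> pt [j jr [ji pt']]; apply: (family_csupp ir jr (nesym ji)).
have [|x [y [e gx gy]]] := @gen_split (supp (p i)) T' q TT.
  apply/genP => t /qv /family_supp[j jr pt]; case: (j =P i) => [<-|ji]; first by left.
  by right; exists j.
have cxy : csupp x y.
  move=> t t' xt yt; apply: TT; first by move/genP: gx; apply.
  by move/genP: gy; apply.
have := H_split X1q e cxy; rewrite Hq => /supp_zpowers hx.
have xs : supp x s.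
  move: qs; rewrite e suppM // => -[//|yt]; case: (@adj_irr s); apply: TT => //.
  by move/genP: gy; apply.
by rewrite -(hx s xs); apply/genP.
Qed.

End PrimitiveFamily.

Lemma pow_eq1 (p : G) n : p <> 1 -> p ^+ n = 1 -> n = 0%N.
Proof.
case: n => // n /supp_neq1[s ps] e; case: (@supp1 s).
by rewrite -e supp_pow.
Qed.

(** Factors of two decompositions that share a letter have equal supports, commute, and lie in each
    other's cyclic groups; each is a positive power of the other, and the absence of torsion makes
    the exponents 1. *)
Lemma family_uniq (I J : eqType) (r : seq I) (r' : seq J) p m q k (v : G) i :
  primitive_family r p m v -> primitive_family r' q k v -> i \in r ->
  exists2 j, j \in r' & p i = q j.
Proof.
move=> pf qf ir; have X1v : X S v 1 by case: pf.
have [s ps] := supp_neq1 (family_neq1 pf ir).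
have pv : supp (p i) `<=` supp v by move=> t [W /(family_Nw pf ir) Wv <-]; exists W.
have [j jr qs] := family_supp qf (pv s ps); exists j => //.
have qv : supp (q j) `<=` supp v by move=> t [W /(family_Nw qf jr) Wv <-]; exists W.
have Xp := family_X1 pf ir; have Xq := family_X1 qf jr.
have Hp := family_primitive pf ir; have Hq := family_primitive qf jr.
have qp := family_absorb pf ir Xq Hq qv qs ps.
have pq := family_absorb qf jr Xp Hp pv ps qs.
have c : commute (p i) (q j) by apply: (H_commute X1v);
  [apply: (family_H pf)|apply: (family_H qf)].
have key (I' J' : eqType) (r1 : seq I') (r2 : seq J') p1 m1 p2 m2 i1 i2 :
    primitive_family r1 p1 m1 v -> primitive_family r2 p2 m2 v -> i1 \in r1 ->
      i2 \in r2 ->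
    commute (p1 i1) (p2 i2) -> supp (p2 i2) `<=` supp (p1 i1) ->
    exists n, p2 i2 = p1 i1 ^+ n.
  move=> f1 f2 r1i r2i c12 s21; set x := p1 i1 in c12 s21 *;
    set y := p2 i2 in c12 s21 *.
  have Xx := family_X1 f1 r1i.
  have : H S x y.
    apply/(HP _ Xx); split=> // W Wy; apply: (family_ax_supp f1 r1i).
      by apply: Nw_ax => //; apply: (family_Nw f2 r2i).
    by apply: s21; exists W.
  rewrite (family_primitive f1 r1i) => -[n [e|e]]; first by exists n.
  case: n e => [|n] e; first by exists 0%N; rewrite e invg1.
  (* A negative exponent is excluded: for a wall V of x^-1, v would cross V and [act x V] in
     opposite directions, whereas v commutes with x and moves both the same way. *)
  have x1 : x^-1 <> 1 by move/eqP; rewrite invg_eq1 => /eqP /(family_neq1 f1 r1i).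
  have [t [V Vx _]] := supp_neq1 x1.
  have xVx : act x V \in Nw x by move: Vx;
    rewrite !Nw_pos !pos_act mulVg mulg1 eq_sym.
  have Vv : V \in Nw v.
    apply: (family_Nw f2 r2i); rewrite -/y e -expVgn.
    apply: reduced_powP => // U U1; rewrite invgK => U2.
    by move/X1: Xx => /(_ U); apply.
  have xVv : act x V \in Nw v by apply: (family_Nw f1 r1i).
  have red := iffLR (X1 v) X1v.
  have [cx _] := iffLR (HP _ X1v) (family_H f1 r1i).
  have s2 : sub v V (pos (act x V) v).
    by rewrite -(actK x V); apply: sub_act; [apply: commuteV|rewrite actVK;
      apply: reduced_sub].
  have e1 : pos (act x V) v = ~~ pos V v.
    have ex : pos (act x V) x = pos V 1 by rewrite pos_act mulVg.
    move: Vv xVv xVx; rewrite !Nw_pos ex.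
    by case: (pos V v) (pos V 1) (pos (act x V) v) (pos (act x V) 1) => -[] [] [].
  have := s2 1; rewrite mulg1 e1.
  by move: Vv; rewrite Nw_pos; case: (pos V v) (pos V 1) => -[] // _ /(_ erefl).
have [n en] := key _ _ _ _ _ _ _ _ _ _ pf qf ir jr c qp.
have [n' en'] := key _ _ _ _ _ _ _ _ _ _ qf pf jr ir (commute_sym c) pq.
have p1 := family_neq1 pf ir.
have : p i ^+ (n * n').-1 = 1.
  apply: (@mulgI _ (p i)); rewrite -expgS mulg1 prednK;
    first by rewrite expgnA -en -en'.
  rewrite muln_gt0; case: n en => [e|n _]; first by case: (family_neq1 qf jr).
  by case: n' en' => // e; case: p1.
move/(pow_eq1 p1) => e.
suff n1 : n = 1%N by rewrite en n1 expg1.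
have n0 : (0 < n)%N by case: n en {e} => // e; case: (family_neq1 qf jr).
have n0' : (0 < n')%N by case: n' en' {e} => // e; case: p1.
by nia.
Qed.

Lemma tau_neq0 (v : G) t z : tau v t z <> 0%R ->
  exists W, [/\ W \in Nw z, ax v W & W.1 = t].
Proof.
move=> n0; apply: contrapT => h; apply: n0;
  rewrite /tau coc_Nw big_seq big1 // => W Wz.
rewrite /axis_weight; case: asboolP => [[aW tW]|_]; last by rewrite mulr0.
by case: h; exists W.
Qed.

(* An element of H_v which does not translate along the axis in the direction t
   fixes its walls of type t; they are transverse to the walls along which it
   does translate. *)
Lemma tau_adj (v : G) t r z : X S v 1 -> H S v z -> supp v t ->
  tau v t z = 0%R -> tau v r z <> 0%R -> adj S t r.
Proof.
move=> X1v Hz [W Wv Wt] tz rz; have [cz _] := iffLR (HP _ X1v) Hz.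
have aW := Nw_ax X1v Wv; have [iW _ _] := aW.
(* Since [tau v t z] vanishes, no axial wall of type t separates a point from its image under z, so
   z preserves both sides of its translate of W. *)
have zW : act z W = W.
  apply: pos_inj => // b; have aZ : ax v (act z W) by apply: ax_act.
  have e : pos (act z W) b = pos (act z W) (z * b).
    apply/eqP; apply: contraT; rewrite -mem_sep => h; exfalso.
    apply: (@tau_sep v t b (z * b) (act z W)) => //.
    by rewrite tauM // tz add0r.
  by rewrite e posM.
have [V [Vz aV Vr]] := tau_neq0 rz; have [iV nV _] := aV.
rewrite -Wt -Vr; apply: (fix_ax_adj iW zW); split=> //; last first.
  by move=> e; move: Vz; rewrite Nw_pos -{1}(mulg1 z) fix_pos // eqxx.
(* z cannot push a side of V off itself: V and its translate by z^-1 are axial walls which v moves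
   the same way, so their corresponding sides share a point. *)
case: (nonper_disj z V) => // -[b db].
have aV' : ax v (act z^-1 V) by apply: ax_act => //; apply: commuteV.
suff [y [yb zb]] : exists y, pos V y = b /\ pos (act z^-1 V) y = b.
  by move: zb; rewrite posV db //; case: (b).
have [c sV] : exists c, sub v V c by case: nV; [exists true|exists false].
have sV' : sub v (act z^-1 V) c by apply: sub_act => //; apply: commuteV.
case: (c =P b) => [<-|cb]; first exact: ax_same_end sV sV'.
have -> : b = ~~ c by case: (b) (c) cb => -[].
exact: (ax_same_end (axV aV) (axV aV') (subV sV) (subV sV')).
Qed.

Lemma zpowersM w z : zpowers w z -> zpowers w (z * w) /\ zpowers w (z * w^-1).
Proof.
case=> n [] ->.
  split; first by exists n.+1; left; rewrite expgSr.
  case: n => [|n]; first by exists 1%N; right; rewrite mul1g expg1.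
  by exists n; left; rewrite expgSr mulgK.
split; last by exists n.+1; right; rewrite expgS invgM.
case: n => [|n]; first by exists 1%N; left; rewrite invg1 mul1g expg1.
by exists n; right; rewrite expgS invgM mulgVK.
Qed.

Lemma zpowersV (w : G) : zpowers w^-1 = zpowers w.
Proof.
apply/seteqP; split=> z [n [] ->]; exists n; rewrite expVgn ?invgK.
- by right.
- by left.
- by right.
- by left.
Qed.

(** * Cyclic groups [H S v] and existence of decompositions *)

Definition splits (v : G) : Prop :=
  exists x y, [/\ v = x * y, csupp x y, x <> 1 & y <> 1].

(** For z in [H S v], the types with zero and with nonzero [tau] commute with each other. As v does
    not split, one vanishing value forces all to vanish, so a single [tau] embeds the group in the
    integers. *)
Lemma H_cyclic (v : G) : X S v 1 -> v <> 1 -> ~ splits v ->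
  exists (u : G) n, [/\ (0 < n)%N, v = u ^+ n & H S v = zpowers u].
Proof.
move=> X1v v1 ns; have [s vs] := supp_neq1 v1.
have inj z : H S v z -> tau v s z = 0%R -> z = 1.
  move=> Hz sz.
  pose T := [set t | supp v t /\ tau v t z = 0%R].
  pose T' := [set t | supp v t /\ tau v t z <> 0%R].
  have TT t t' : T t -> T' t' -> adj S t t'.
    by move=> [vt tz] [_ tz']; apply: tau_adj tz tz'.
  have [|x [y [e gx gy]]] := @gen_split T T' v TT.
    apply/genP => t vt; case: (pselect (tau v t z = 0%R)); first by left.
    by right.
  have cxy : csupp x y.
    move=> t t' xt yt; apply: TT; first by move/genP: gx; apply.
    by move/genP: gy; apply.
  have x1 : x <> 1.
    move=> ex; move: vs; rewrite e ex mul1g; move/genP: gy => gy /gy [_].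
    by rewrite sz.
  have y1 : y = 1 by apply: contrapT => y1; apply: ns; exists x, y.
  apply: (H_eq1 X1v Hz) => t; rewrite e y1 mulg1; move/genP: gx => gx /gx[_].
  by rewrite e y1 mulg1.
have ex : exists n, `[< exists2 u : G, H S v u & tau v s u <> 0%R /\
  `|tau v s u|%N = n >].
  exists `|tau v s v|%N; apply/asboolP; exists v; first exact: H_id.
  by split=> // /(inj v (H_id X1v)).
case: (ex_minnP ex) => n /asboolP[u Hu [u0 un]] nmin.
have [cu _] := iffLR (HP _ X1v) Hu.
have tV := tauV s cu.
have gen_u z : H S v z -> zpowers u z.
  have [k] := ubnP `|tau v s z|%N; elim: k z => // k IH z; rewrite ltnS => lk Hz.
  case: (tau v s z =P 0%R) => [/(inj z Hz)->|z0].
    by exists 0%N; left.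
  have le : (n <= `|tau v s z|)%N by apply: nmin; apply/asboolP; exists z.
  have [cz _] := iffLR (HP _ X1v) Hz.
  have t1 := tauM s u cz; have t2 := tauM s u^-1 cz.
  (* Euclidean descent: as u has the least nonzero absolute value, z u or z u^-1 has a smaller one
     than z. *)
  case: (leqP `|tau v s (z * u)| `|tau v s z|.-1) => h.
    have /zpowersM[_] : zpowers u (z * u).
      by apply: IH; [lia|apply: H_M].
    by rewrite mulgK.
  have /zpowersM[+ _] : zpowers u (z * u^-1).
    apply: IH; last by apply: H_M => //; apply: H_V.
    by move: t1 t2 h lk le un u0 z0; rewrite tV; lia.
  by rewrite mulgVK.
have HE : H S v = zpowers u.
  apply/seteqP; split=> [z /gen_u //|z [m [] ->]]; last first.
    by apply: (H_V X1v); elim: m => [|m IH]; [apply: H_1|rewrite expgS; apply: H_M].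
  by elim: m => [|m IH]; [apply: H_1|rewrite expgS; apply: H_M].
have [m [em|em]] := gen_u v (H_id X1v).
  by exists u, m; split=> //; case: m em => // em; case: v1.
(* The generator is replaced by its inverse to make the exponent of v positive. *)
exists u^-1, m; rewrite zpowersV expVgn; split=> //.
by case: m em => // em; case: v1; rewrite em invg1.
Qed.

Lemma family_ex (v : G) : X S v 1 ->
  exists l : seq (G * nat), primitive_family l fst snd v.
Proof.
have [n] := ubnP (len S v); elim: n v => // n IH v; rewrite ltnS => lv X1v.
case: (pselect (v = 1)) => [->|v1].
  exists [::]; split=> //; last by rewrite big_nil.
  by apply/X1 => W; rewrite Nw1.
case: (pselect (splits v)) => [[x [y [e h x1 y1]]]|ns]; last first.
  have [u [m [m0 em HE]]] := H_cyclic X1v v1 ns.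
  have X1u : X S u 1 by rewrite -(X_pow u m0) -em.
  have u1 : u <> 1 by move=> u1; case: v1; rewrite em u1 expg1n.
  exists [:: (u, m)]; split=> //.
  - by rewrite big_cons big_nil mulg1.
  - by split=> // i j; rewrite !inE => /eqP-> /eqP->.
  move=> i; rewrite inE => /eqP-> /=; split=> //.
  (* u is itself primitive: what commutes with u commutes with its power v, and both have the same
     axial walls, so [H S u] lies in [H S v]. *)
  apply/seteqP; split=> z; last exact: zpowers_H.
  move=> /(HP _ X1u)[cz hz]; rewrite -HE; apply/(HP _ X1v).
  split=> [|W /hz aW]; last by rewrite em; apply/axX.
  by rewrite em; apply: commute_sym; apply: commuteX; apply: commute_sym.
rewrite e in X1v; have X1x := csuppM_X1 h X1v.
have X1y : X S y 1 by apply: csuppM_X1 (csupp_sym h) _; rewrite -(csupp_commute h).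
have short x' y' : csupp x' y' -> y' <> 1 -> (len S x' < len S (x' * y'))%N.
  move=> h' /supp_neq1[s [W0 W0y _]]; rewrite -!size_Nw.
  apply: (@uniq_leq_size _ (W0 :: Nw x')).
    by rewrite /= uniq_Nw andbT; apply/negP => W0x;
      apply: csupp_Nw_disjoint h' W0x W0y.
  by move=> V; rewrite inE csuppM_Nw // => /orP[/eqP->|->//]; rewrite W0y orbT.
have [lx fx] : exists l, primitive_family l fst snd x.
  by apply: IH => //; apply: leq_trans lv; rewrite e; apply: short.
have [ly fy] : exists l, primitive_family l fst snd y.
  apply: IH => //; apply: leq_trans lv; rewrite e (csupp_commute h).
  by apply: short => //; apply: csupp_sym.
have sub_x i : i \in lx -> supp (i.1 ^+ i.2) `<=` supp x.
  move=> il; rewrite supp_pow; last exact: (family_gt0 fx).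
  by move=> s [W /(family_Nw fx il) ? <-]; exists W.
have sub_y i : i \in ly -> supp (i.1 ^+ i.2) `<=` supp y.
  move=> il; rewrite supp_pow; last exact: (family_gt0 fy).
  by move=> s [W /(family_Nw fy il) ? <-]; exists W.
have cross i j : i \in lx -> j \in ly -> csupp (i.1 ^+ i.2) (j.1 ^+ j.2).
  by move=> il jl s t /(sub_x i il) xs /(sub_y j jl) yt; apply: h.
case: (fx) => _ ex [ux ox] px; case: (fy) => _ ey [uy oy] py.
exists (lx ++ ly); split; first by rewrite e.
- by rewrite big_cat /= -ex -ey.
- split=> [|i j].
    rewrite cat_uniq ux uy andbT /=; apply/hasPn => i iy; apply/negP => ix.
    have [i0 i1 _] := px i ix; have [s s1] := supp_neq1 i1.
    apply: (@adj_irr s); apply: (cross i i ix iy); rewrite supp_pow //.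
  rewrite !mem_cat => /orP[ix|iy] /orP[jx|jy] ij.
  + exact: ox.
  + exact: cross.
  + exact/csupp_sym/cross.
  + exact: oy.
by move=> i; rewrite mem_cat => /orP[/px|/py].
Qed.

Lemma decomposition_family (w a : G) n (p : 'I_n -> G) (m : 'I_n -> nat) :
  X S w a -> primitive_decomposition S w p m ->
  primitive_family (index_enum 'I_n) (fun i => p i ^ a) m (w ^ a).
Proof.
move=> Xwa [ew pp m0 op].
have ewa : w ^ a = \prod_(i < n) (p i ^ a) ^+ m i.
  by rewrite {1}ew conjg_prod; apply: eq_bigr => i _; rewrite conjXg.
have orth : orth_family (index_enum 'I_n) (fun i => (p i ^ a) ^+ m i).
  split; first exact: index_enum_uniq.
  move=> i j _ _ ij s t; rewrite !supp_pow //.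
  by have /orthogonalP h := op i j ij a Xwa; apply: h.
have X1 : X S (w ^ a) 1 by exact: (iffLR (XJ1 w a) Xwa).
split=> // i _; have [p1 _] := pp i; split=> //.
  by move/eqP; rewrite conjg_eq1 => /eqP.
apply: primitiveP => //; apply: (iffRL (XJ1 _ _)).
rewrite -(X_pow (p i ^ a) (m0 i)).
have [|h _ _] := orth_prod_X orth; first by rewrite -ewa.
by move: X1; rewrite ewa h; apply; apply: mem_index_enum.
Qed.

Lemma decomposition_ex (w : G) : exists n (p : 'I_n -> G) (m : 'I_n -> nat),
  primitive_decomposition S w p m.
Proof.
have Xwa := X_phi w 1; set a := phi S w 1 in Xwa; set v := w ^ a.
have [l fl] := family_ex (iffLR (XJ1 w a) Xwa).
case: (fl) => X1v ev [ul ol] pl.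
pose e (i : 'I_(size l)) := tnth (in_tuple l) i.
have el i : e i \in l by apply: mem_tnth.
exists (size l), (fun i => (e i).1 ^ a^-1), (fun i => (e i).2); split.
- rewrite -(conjgK a w) ev conjg_prod (big_tnth _ _ l).
  by apply: eq_bigr => i _; rewrite conjXg.
- move=> i; have [_ i1 Hi] := pl _ (el i); split.
    by move/eqP; rewrite conjg_eq1 => /eqP.
  exists a; last by rewrite conjgKV.
  by apply: (iffRL (XJ1 _ _)); rewrite conjgKV; apply: (family_X1 fl).
- by move=> i; apply: (family_gt0 fl).
move=> i j ij b Xwb; apply/orthogonalP; rewrite -!conjgM.
have Xc : X S v (a^-1 * b) by apply: (iffRL (XJ _ _ _)); rewrite mulVKg.
(* Orthogonality is required at every point b of [X S w]. A letter of a^-1 b belongs to the support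
   of one factor or is adjacent to all, so conjugation keeps each factor within its support. *)
have gc k : k \in l -> gen (supp k.1) (k.1 ^ (a^-1 * b)).
  move=> kl; apply: gen_conj (@gen_supp _) _ => s cs.
  have kv t : supp k.1 t -> supp v t by case=> W /(family_Nw fl kl) ? <-; exists W.
  case: (X_supp X1v Xc cs) => [/(family_supp fl)[k' k'l ks]|hs].
    case: (k' =P k) => [<-|kk]; first by left.
    by right=> t kt; apply: (family_csupp fl k'l kl kk).
  by right=> t /kv; apply: hs.
apply: csupp_gen (gc _ (el i)) (gc _ (el j)).
apply: (family_csupp fl) => // eij; apply: ij; apply: ord_inj.
have := eij; rewrite /e !(tnth_nth (1, 0%N)) /= => /eqP.
by rewrite nth_uniq // => /eqP.
Qed.

Lemma Prim_decomposition (w : G) n (p : 'I_n -> G) (m : 'I_n -> nat) :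
  primitive_decomposition S w p m -> injective p /\ Prim S w = range p.
Proof.
move=> d; have Xwa := X_phi w 1; set a := phi S w 1 in Xwa.
have f := decomposition_family Xwa d; split.
  move=> i j e; apply: (family_inj f); try exact: mem_index_enum.
  by rewrite e.
apply/seteqP; split=> q; last by case=> i _ <-; exists n, p, m; split=> //; exists i.
case=> n' [p' [m' [d' [i ->]]]].
have [j _ e] := family_uniq (decomposition_family Xwa d') f (mem_index_enum i).
by exists j => //; apply: (@conjg_inj G a); apply/esym.
Qed.

(** * The set of primitive factors *)

Section Prim.
Variable w : G.

Lemma Prim_finite : finite_set (Prim S w).
Proof.
have [n [p [m d]]] := decomposition_ex w; have [_ ->] := Prim_decomposition d.
apply/finite_seqP; exists [seq p i | i <- enum 'I_n].
apply/seteqP; split=> q; first by case=> i _ <-; apply/mapP; exists i;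
  rewrite ?mem_enum.
by case/mapP => i _ ->; exists i.
Qed.

(** Facts on [Prim] are read off from one decomposition conjugated to the base point a. *)
Lemma Prim_family_transfer (P : G -> Prop) :
  (forall n (p : 'I_n -> G) (m : 'I_n -> nat) a, X S w a ->
    primitive_decomposition S w p m ->
    (forall q, Prim S w q <-> exists i, q = p i) -> P a) ->
  forall a, X S w a -> P a.
Proof.
move=> h a Xwa; have [n [p [m d]]] := decomposition_ex w.
have [_ e] := Prim_decomposition d; apply: (h n p m) => // q; rewrite e.
by split=> [[i _ <-]|[i ->]]; exists i.
Qed.

Lemma Prim_X c : X S w c <-> forall q, Prim S w q -> X S q c.
Proof.
pose P (a : G) := X S w c <-> forall q, Prim S w q -> X S q c.
apply: (@Prim_family_transfer P _ (phi S w 1)); last exact: X_phi.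
move=> n p m a Xwa d e; have f := decomposition_family Xwa d.
have := family_X f (a^-1 * c); rewrite (XJ w a) mulVKg /P => ->.
split=> [h q /e[i ->]|h i _]; last by apply: (iffRL (XJ _ _ _)); rewrite mulVKg;
  apply: h; apply/e; exists i.
by have := h i (mem_index_enum i); rewrite (XJ (p i) a) mulVKg.
Qed.

Lemma Prim_nonper W : isw W -> nonper w W <-> forall q, Prim S w q -> nonper q W.
Proof.
move=> iW; pose P (a : G) := nonper w W <-> forall q, Prim S w q -> nonper q W.
apply: (@Prim_family_transfer P _ (phi S w 1)); last exact: X_phi.
move=> n p m a Xwa d e; have f := decomposition_family Xwa d.
have := family_nonper f (isw_act a^-1 iW); rewrite (nonperJ w a) actVK /P => ->.
split=> [h q /e[i ->]|h i _]; last by apply: (iffRL (nonperJ _ _ _)); rewrite actVK;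
  apply: h; apply/e; exists i.
by have := h i (mem_index_enum i); rewrite (nonperJ (p i) a) actVK.
Qed.

Lemma Prim_ax W : ax w W <-> exists2 q, Prim S w q & ax q W.
Proof.
pose P (a : G) := ax w W <-> exists2 q, Prim S w q & ax q W.
apply: (@Prim_family_transfer P _ (phi S w 1)); last exact: X_phi.
move=> n p m a Xwa d e; have f := decomposition_family Xwa d.
have := family_ax f (act a^-1 W); rewrite (axJ w a) actVK /P => ->.
split=> [[i _]|[q /e[i ->] h]].
  by rewrite (axJ (p i) a) actVK; exists (p i) => //; apply/e; exists i.
by exists i; rewrite ?mem_index_enum //; apply: (iffRL (axJ _ _ _)); rewrite actVK.
Qed.

Lemma Prim_csupp a q q' : X S w a -> Prim S w q -> Prim S w q' -> q <> q' ->
  csupp (q ^ a) (q' ^ a).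
Proof.
move=> Xwa; pose P (a : G) := Prim S w q -> Prim S w q' -> q <> q' ->
  csupp (q ^ a) (q' ^ a).
apply: (@Prim_family_transfer P _ a Xwa) => n p m b Xwb d e /e[i ->] /e[j ->] ij.
apply: (family_csupp (decomposition_family Xwb d)); rewrite ?mem_index_enum //.
by move=> eij; apply: ij; rewrite eij.
Qed.

(** * Convex closure and product decomposition of [Xa] *)

Lemma Xa_id (q : G) a : Xa S q a a.
Proof.
move=> I [_ h]; apply: h; exists 1; last by rewrite mul1g.
by exists 0%N; left.
Qed.

(** A wall between x and its nearest point in a convex set containing all the factors is axial for
    w, hence for some q in [Prim S w]; but the powers of q already move a across it. *)
Lemma Xa_closure a : X S w a ->
  Xa S w a = convex_closure S (pointed_bigcup a (Prim S w) (fun p => Xa S p a)).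
Proof.
move=> Xwa; set B := pointed_bigcup _ _ _.
have Ba : B a.
  rewrite /B /pointed_bigcup; case: eqP => // /eqP/set0P[q Pq].
  by exists q => //; apply: Xa_id.
have Bq q : Prim S w q -> Xa S q a `<=` B.
  move=> Pq x qx; rewrite /B /pointed_bigcup; case: eqP => [e|_];
    first by rewrite e in Pq.
  by exists q.
have Xq q : Prim S w q -> X S q a by move=> Pq; apply: (iffLR (Prim_X a)).
apply/seteqP; split=> x; last first.
  move=> h; apply: h; split; first exact: Xa_convex.
  move=> y; rewrite /B /pointed_bigcup;
    case: eqP => [_ ->|_ [q Pq /(XaP _ (Xq q Pq)) hy]].
    exact: Xa_id.
  by apply/(XaP _ Xwa) => W /hy aq; apply/Prim_ax; exists q.
move=> /(XaP _ Xwa) hx I [cI sI].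
have [y Iy hy] := gate x cI (ex_intro I a (sI a Ba)); suff -> : x = y by [].
apply: eq_pos => W; apply/eqP; apply: contraT; rewrite -mem_sep => Wxy.
have Wax : W \in sep a x.
  by rewrite mem_sep (hy a W (sI a Ba) Wxy); move: Wxy; rewrite mem_sep eq_sym.
have [q Pq aq] := iffLR (Prim_ax W) (hx W Wax).
have [z zq zb] := ax_ends (~~ pos W y) a aq.
have Iz : I (z * a).
  apply: sI; apply: (Bq q Pq) => J [_]; apply.
  by exists z.
by move: zb; rewrite (hy _ _ Iz Wxy); case: (pos W y).
Qed.

(** The coordinate of x at q is its nearest point in [Xa S q a]: it agrees with x on the axial walls
    of q and with a on all others. Medians are computed wall by wall, so they are preserved. *)
Lemma Xa_iso a : X S w a ->
  median_iso (Y S) (componentwise (Y S)) (Xa S w a)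
    (prod_set (fun p : set_type (Prim S w) => Xa S (val p) a)).
Proof.
move=> Xwa; have Xq q : Prim S w q -> X S q a by move=> Pq; apply: (iffLR (Prim_X a)).
have Pv (q : set_type (Prim S w)) : Prim S w (val q) by apply: set_mem (valP q).
pose good q x y := forall W, (ax q W -> pos W y = pos W x) /\ (~ ax q W ->
  pos W y = pos W a).
have good_uniq q x y y' : good q x y -> good q x y' -> y = y'.
  move=> h h'; apply: eq_pos => W; have [h1 h2] := h W; have [h1' h2'] := h' W.
  by case: (pselect (ax q W)) => c; [rewrite h1 ?h1'|rewrite h2 ?h2'].
have good_ex q x : Prim S w q -> Xa S w a x -> exists y, good q x y.
  move=> Pq hx.
  have [y Iy hy] := gate x (@Xa_convex q a) (ex_intro (Xa S q a) a (@Xa_id q a)).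
  exists y => W; split=> [aq|naq]; last first.
    apply/eqP; apply: contraT => h; case: naq; apply: (iffLR (XaP _ (Xq q Pq)) Iy).
    by rewrite mem_sep eq_sym.
  apply/esym/eqP; apply: contraT; rewrite -mem_sep => Wxy.
  have [z zq zb] := ax_ends (~~ pos W y) a aq.
  have Iz : Xa S q a (z * a) by move=> J [_]; apply; exists z.
  by move: zb; rewrite (hy _ _ Iz Wxy); case: (pos W y).
pose f x : set_type (Prim S w) -> G := fun q => xget 1 [set y | good (val q) x y].
have fP x q : Xa S w a x -> good (val q) x (f x q).
  by move=> hx; have [y hy] := good_ex (val q) x (Pv q) hx;
    apply: (@xgetPex _ 1 [set y | good (val q) x y]); exists y.
exists f; last first.
  move=> x y z hx hy hz; apply/funext => q; rewrite /componentwise.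
  have hm : Xa S w a (Y S x y z).
    apply: (@Xa_convex w a x y hx hy); apply/intervalP => W; rewrite YE.
    by case: (pos W x) (pos W y) (pos W z) => -[] [].
  apply: (good_uniq (val q) (Y S x y z)); first exact: fP.
  move=> W; rewrite !YE.
  have [h1 h1'] := fP x q hx W; have [h2 h2'] := fP y q hy W;
    have [h3 h3'] := fP z q hz W.
  split=> c; first by rewrite h1 // h2 // h3.
  by rewrite h1' // h2' // h3' //; case: (pos W a).
split.
- move=> x hx q; apply/(XaP _ (Xq _ (Pv q))) => W; have [_ h] := fP x q hx W.
  by rewrite mem_sep; apply: contraPP => /h ->; rewrite eqxx.
- move=> x y /set_mem hx /set_mem hy e; apply: eq_pos => W.
  have := iffLR (XaP x Xwa) hx W; have := iffLR (XaP y Xwa) hy W; rewrite !mem_sep.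
  case: (pselect (ax w W)) => [/Prim_ax[q Pq aq] _ _|naw].
    pose q' : set_type (Prim S w) := SigSub (mem_set Pq).
    have [h1 _] := fP x q' hx W; have [h2 _] := fP y q' hy W.
    by rewrite -h1 // -h2 // e.
  case: (pos W x =P pos W y) => // ne h1 h2; exfalso; apply: naw.
  by move: ne h1 h2; case: (pos W x) (pos W y) (pos W a) => -[] [] // _; auto.
move=> g hg.
have [n [p [m d]]] := decomposition_ex w; have [pinj eP] := Prim_decomposition d.
have Pp i : Prim S w (p i) by rewrite eP; exists i.
pose pt i : set_type (Prim S w) := SigSub (mem_set (Pp i)).
have hgi i W : W \in sep a (g (pt i)) -> ax (p i) W.
  by apply: (iffLR (XaP _ (Xq _ (Pp i)))); apply: (hg (pt i)).
(* Seen from a, the prescribed coordinates have commuting supports, so the walls of their product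
   are the union of theirs; this gives the preimage. *)
pose y i := a^-1 * g (pt i).
have yN i W : (act a^-1 W \in Nw (y i)) = (W \in sep a (g (pt i))).
  by rewrite -sepM mulVKg.
have orth : orth_family (index_enum 'I_n) y.
  split; first exact: index_enum_uniq.
  move=> i j _ _ ij; have hy k : gen (supp (p k ^ a)) (y k).
    move=> V; rewrite -(actK a V) yN => /hgi ak.
    by apply: ax_supp; apply/axJ; rewrite actVK.
  apply: csupp_gen (hy i) (hy j); apply: Prim_csupp => //.
  by move/pinj.
pose x := a * \prod_(i <- index_enum 'I_n) y i.
have xN W : W \in sep a x <-> exists i, W \in sep a (g (pt i)).
  rewrite sepM (orth_prod_Nw _ orth); split=> [[i _]|[i]]; rewrite -?yN => hi;
    exists i => //.
  by rewrite -yN.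
have hx : Xa S w a x.
  by apply/(XaP _ Xwa) => W /xN[i /hgi ai]; apply/Prim_ax; exists (p i).
exists x => //; apply/funext => q.
have [i ei] : exists i, q = pt i.
  have Pex r : Prim S w r -> exists i, r = p i by rewrite eP => -[i _ <-]; exists i.
  by have [i e] := Pex _ (Pv q); exists i; apply: val_inj; rewrite /= e.
rewrite {}ei; apply: (good_uniq (p i) x); first exact: (fP x (pt i) hx).
move=> W; split=> [ai|nai]; last first.
  by apply/eqP; apply: contraT => h; case: nai; apply: hgi; rewrite mem_sep eq_sym.
(* An axial wall of [p i] cannot come from another coordinate j, since its type would then be
   adjacent to itself. *)
have : W \in sep a x <-> W \in sep a (g (pt i)).
  rewrite xN; split=> [[j hj]|]; last by exists i.
  case: (i =P j) => [->//|ij]; exfalso; apply: (@adj_irr W.1).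
  apply: (Prim_csupp Xwa (Pp i) (Pp j)); first by move/pinj.
    have : ax (p i ^ a) (act a^-1 W) by apply/axJ; rewrite actVK.
    by move/ax_supp.
  have : ax (p j ^ a) (act a^-1 W) by apply/axJ; rewrite actVK; apply: hgi.
  by move/ax_supp.
rewrite !mem_sep; case: (pos W a) (pos W x) (pos W (g (pt i))) => -[] [] // [h1 h2].
- by have := h2 isT.
- by have := h1 isT.
- by have := h1 isT.
- by have := h2 isT.
Qed.

(** A common point c of the images decides the side wherever some factor forgets that of x. The
    outcome does not depend on the order of composition, which is why these foldings commute. *)
Lemma phi_big (s : seq G) c : (forall q, q \in s -> X S q c) ->
  forall x W, isw W ->
  ((forall q, q \in s -> nonper q W) ->
    pos W ((\big[comp/id]_(q <- s) phi S q) x) = pos W x) /\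
  (~ (forall q, q \in s -> nonper q W) ->
    pos W ((\big[comp/id]_(q <- s) phi S q) x) = pos W c).
Proof.
move=> + x W iW; elim: s => [|q s IH] hc; first by rewrite big_nil; split=> // -[].
have [|IH1 IH2] := IH; first by move=> r rs; apply: hc; rewrite inE rs orbT.
have qc : X S q c by apply: hc; rewrite mem_head.
rewrite big_cons /=; case: (nonper_disj q W) => [nq|[b db]].
  rewrite phi_nonper //; split=> h.
    by apply: IH1 => r rs; apply: h; rewrite inE rs orbT.
  by apply: IH2 => h'; apply: h => r; rewrite inE => /orP[/eqP->|/h'].
split=> h; first by case: (disj_nonper iW db); apply: h; rewrite mem_head.
by rewrite (phi_disj _ iW db) (iffLR (XP q c) qc W b iW db).
Qed.

End Prim.

Lemma phi_comm p q c : X S p c -> X S q c -> phi S p \o phi S q = phi S q \o phi S p.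
Proof.
move=> pc qc; apply/funext => x; apply: eq_pos_isw => W iW.
have h1 := @phi_big [:: p; q] c; have h2 := @phi_big [:: q; p] c.
have /h1 {}h1 : forall r, r \in [:: p; q] -> X S r c.
  by move=> r; rewrite !inE => /orP[]/eqP->.
have /h2 {}h2 : forall r, r \in [:: q; p] -> X S r c.
  by move=> r; rewrite !inE => /orP[]/eqP->.
have [h3 h4] := h1 x W iW; have [h5 h6] := h2 x W iW.
move: h3 h4 h5 h6; rewrite !big_cons !big_nil /=.
have e : (forall r, r \in [:: p; q] -> nonper r W) <-> (forall r, r \in [:: q;
  p] -> nonper r W).
  by split=> h r hr; apply: h; move: hr; rewrite !inE orbC.
case: (pselect (forall r, r \in [:: p;
  q] -> nonper r W)) => [n h3 _ h5 _|n _ h4 _ h6].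
  by rewrite h3 // h5 //; apply/e.
by rewrite h4 // h6 // -e.
Qed.

End Raag.

Theorem corollary8p13 (G : groupType) (S : set G) (hGS : raag S) (w : G) :
  [/\ (* (1) *)
      forall a, X S w a ->
        Xa S w a =
          convex_closure S
            (pointed_bigcup a (Prim S w) (fun p => Xa S p a)) /\
        median_iso (Y S) (componentwise (Y S)) (Xa S w a)
          (prod_set (fun p : set_type (Prim S w) => Xa S (val p) a)),
      (* (2) *)
      X S w = \bigcap_(p in Prim S w) X S p,
      (* (3) *)
      [/\ folding S (phi S w),
          forall p, Prim S w p -> folding S (phi S p),
          forall p q, Prim S w p -> Prim S w q ->
            phi S p \o phi S q = phi S q \o phi S p,
          finite_set (Prim S w) &
          forall s : seq G, uniq s -> [set` s] = Prim S w ->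
            phi S w = \big[comp/id]_(p <- s) phi S p] &
      (* (4) *)
      forall u : G, Prim_sym S w `<=` Prim_sym S u ->
        folding_le (phi S u) (phi S w)].
Proof.
have Xw := X_phi S w 1; set c := phi S w 1 in Xw.
have Xc q : Prim S w q -> X S q c by move=> Pq; apply: (iffLR (Prim_X hGS w c)).
split.
- by move=> a Xa; split; [apply: Xa_closure|apply: Xa_iso].
- by apply/seteqP; split=> x; rewrite (Prim_X hGS).
- split.
  + exact: phi_folding.
  + by move=> p _; apply: phi_folding.
  + by move=> p q Pp Pq; apply: (phi_comm hGS (Xc p Pp) (Xc q Pq)).
  + exact: Prim_finite.
  move=> s us es; have sP q : q \in s <-> Prim S w q by rewrite -es.
  apply/funext => x; apply: (eq_pos_isw hGS) => W iW.
  have [|h1 h2] := phi_big hGS (c := c) _ x iW (s := s).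
    by move=> q /sP; apply: Xc.
  have e : nonper S w W <-> forall q, q \in s -> nonper S q W.
    by rewrite (Prim_nonper hGS w iW); split=> h q /sP; apply: h.
  case: (nonper_disj hGS w W) => [n|[b db]].
    by rewrite phi_nonper // h1 //; apply/e.
  rewrite (phi_disj hGS _ iW db) h2 ?(iffLR (XP hGS w c) Xw W b iW db) //.
  by move/e/(disj_nonper iW db).
move=> u wu x Xu; apply/(Prim_X hGS) => q Pq.
(* A factor of u^-1 is as good as one of u, since inversion does not change [X]. *)
have [Pu|Pu] : Prim_sym S u q by apply: wu; left.
  exact: (iffLR (Prim_X hGS u x)).
by apply: (iffLR (Prim_X hGS u^-1 x)) => //; rewrite XV.
Qed.
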